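(* Let $x\in\mathbb{R}^d$, $\delta>0$ and $m\in\mathbb{N}$. For all $i,j\in\{1,\dots,m\}$ the covariance between two second-order temporal increments is given by $$\mathrm{Cov}(\mathbf{I}_{\mathrm{te},i},\mathbf{I}_{\mathrm{te},j})=\delta^{3-\beta}\left((i\wedge j)\,\frac{8}{(2\pi)^d\vartheta^{\beta/2}}\int_{\mathbb{R}^d}\cos((i-j)|\omega|)\,g_{\mathrm{te}}(\omega)\,d\omega+R(i,j)\right),$$ where $g_{\mathrm{te}}(\omega)=\sin^4(|\omega|/2)|\omega|^{\beta-d-2}$ and $R(i,j)=R^{(1)}(i,j)+R^{(2)}(i,j)+R^{(3)}(i,j)$ with $$R^{(1)}(i,j)=\frac{4}{(2\pi)^d\vartheta^{\beta/2}}\int_{\mathbb{R}^d}\sin^4(|\omega|/2)\,r^{(1)}_{i,j}(|\omega|)\,|\omega|^{\beta-d-3}\,d\omega,$$ $$R^{(z)}(i,j)=\frac{1}{2(2\pi)^d\vartheta^{\beta/2}}\int_{\mathbb{R}^d}r^{(z)}_{i,j}(|\omega|)\,|\omega|^{\beta-d-2}\,d\omega,\qquad z\in\{2,3\},$$ the functions $r^{(z)}_{i,j}$ being those defined in the context. Moreover, $|R(i,j)|$ is bounded by a constant independent of $i$ and $j$.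
   Context: Let $d\in\mathbb{N}$, $\beta\in(0,\min(2,d))$ and $\vartheta>0$. $u=(u(t,x))_{t\ge0,x\in\mathbb{R}^d}$ denotes the solution of the stochastic wave equation $\partial_{tt}^2u=\vartheta\Delta u+\dot W_\beta$ on $\mathbb{R}^d$ with $u(0,\cdot)=\partial_tu(0,\cdot)\equiv0$, driven by centred Gaussian noise that is white in time and has Riesz-kernel spatial covariance (proportional to $|x-y|^{-\beta}$) with spectral density $|\xi|^{\beta-d}$. That is, $u$ is the centred Gaussian process with covariance $$\mathbb{E}[u(t,x)u(s,y)]=\frac{1}{(2\pi)^d}\int_0^{t\wedge s}\int_{\mathbb{R}^d}e^{\mathrm{i}(x-y)\cdot\xi}\,\frac{\sin((t-r)\sqrt\vartheta|\xi|)}{\sqrt\vartheta|\xi|}\,\frac{\sin((s-r)\sqrt\vartheta|\xi|)}{\sqrt\vartheta|\xi|}\,|\xi|^{\beta-d}\,d\xi\,dr.$$ Observation times: $t_i=\delta i$, $i=0,\dots,m+1$; increments $\mathbf{I}_{\mathrm{te},i}=u(t_{i+1},x)+u(t_{i-1},x)-2u(t_i,x)$, $i=1,\dots,m$. Here $\mathrm{sinc}(x)=\sin(x)/x$ and $i\wedge j=\min(i,j)$. Define $$r^{(1)}_{i,j}(\xi)=\begin{cases}-\sin(2i\xi),&i=j,\\-\sin((i+j)\xi),&|i-j|=1,\\\sin(|i-j|\xi)-\sin((i+j)\xi),&|i-j|\ge2,\end{cases}$$ $$r^{(2)}_{i,j}(\xi)=\begin{cases}4\cos(\xi)-2\cos(2\xi)-4\,\mathrm{sinc}(\xi)+2\,\mathrm{sinc}(2\xi),&i=j,\\-\cos(\xi)+\tfrac72\mathrm{sinc}(\xi)+\tfrac32\mathrm{sinc}(3\xi)-4\,\mathrm{sinc}(2\xi),&|i-j|=1,\\0,&|i-j|\ge2,\end{cases}$$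 $$r^{(3)}_{i,j}(\xi)=\begin{cases}0,&i=j,\\-8\sin^2(\xi)\sin^2(\xi/2),&|i-j|=1,\\-8\sin(\xi)\sin^2(\xi/2)\sin(|i-j|\xi),&|i-j|\ge2.\end{cases}$$ *)

(* Defs.v *)
From HB Require Import structures.
From mathcomp Require Export all_boot all_order all_algebra.
From mathcomp Require Export all_classical all_reals all_analysis.
From mathcomp Require Export complex.

Set Implicit Arguments.
Unset Strict Implicit.
Unset Printing Implicit Defensive.
Import Order.TTheory GRing.Theory Num.Theory.
Import numFieldNormedType.Exports.

Local Open Scope classical_set_scope.
Local Open Scope ring_scope.

(* R^n carries the product sigma-algebra; the library has no Lebesgue measure on
   it, so [lebesgue_Rn] below is the n-fold product of the one on R. *)
Notation Rn R n := (n.-tuple (measurableTypeR R)).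

Section lebesgue_Rn.
Context {R : realType}.

Definition cons_tuple n (p : measurableTypeR R * Rn R n) : Rn R n.+1 :=
  [the n.+1.-tuple (measurableTypeR R) of p.1 :: p.2].

Lemma measurable_cons_tuple n : measurable_fun [set: _] (@cons_tuple n).
Proof. exact: measurable_cons. Qed.

Section cons_measure.
Variables (n : nat) (m : {sigma_finite_measure set (Rn R n) -> \bar R}).

Definition cons_measure : set (Rn R n.+1) -> \bar R :=
  pushforward (@lebesgue_measure R \x m)%E (@cons_tuple n).

Let mpre A : measurable A -> measurable (@cons_tuple n @^-1` A).
Proof.
by move=> mA; rewrite -[X in measurable X]setTI; exact: measurable_cons_tuple.
Qed.

Let cons_measure0 : cons_measure set0 = 0%E.
Proof. by rewrite /cons_measure /pushforward preimage_set0 measure0. Qed.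

Let cons_measure_ge0 A : (0 <= cons_measure A)%E.
Proof.
by rewrite /cons_measure; exact: (measure_ge0 (@lebesgue_measure R \x m)%E).
Qed.

Let cons_measure_sigma_additive : semi_sigma_additive cons_measure.
Proof.
move=> F mF tF mUF; rewrite /cons_measure /pushforward preimage_bigcup.
apply: measure_semi_sigma_additive.
- by move=> k; exact: mpre.
- apply/trivIsetP => /= i j _ _ ij; rewrite -preimage_setI.
  by move/trivIsetP : tF => /(_ _ _ _ _ ij) ->//; rewrite preimage_set0.
- by rewrite -preimage_bigcup; exact: mpre.
Qed.

HB.instance Definition _ := isMeasure.Build _ _ _ cons_measure
  cons_measure0 cons_measure_ge0 cons_measure_sigma_additive.

Let cons_measure_sigma_finite : sigma_finite setT cons_measure.
Proof.
have /sigma_finiteP[F [FT ndF Foo]] := sigma_finiteT (@lebesgue_measure R).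
have /sigma_finiteP[G [GT ndG Goo]] := sigma_finiteT m.
pose uncons (x : Rn R n.+1) : measurableTypeR R * Rn R n :=
  (thead x, [tuple of behead x]).
have unconsK : cancel (@cons_tuple n) uncons.
  case=> a t; rewrite /uncons /cons_tuple /=; congr pair.
  exact: val_inj.
have muncons : measurable_fun setT uncons.
  apply/measurable_fun_pairP; split; first exact: measurable_tnth.
  exact: measurable_behead.
exists (fun k => uncons @^-1` (F k `*` G k)).
  apply/esym/seteqP; split => // x _ /=.
  have [i _ Fi] : (\bigcup_i F i) (uncons x).1 by rewrite -FT.
  have [j _ Gj] : (\bigcup_j G j) (uncons x).2 by rewrite -GT.
  exists (maxn i j) => //; split.
    by move: Fi; exact/subsetPset/ndF/leq_maxl.
  by move: Gj; exact/subsetPset/ndG/leq_maxr.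
move=> k; have [mF Fk] := Foo k; have [mG Gk] := Goo k; split.
  by rewrite -[X in measurable X]setTI; apply: muncons => //; exact: measurableX.
rewrite /cons_measure /pushforward.
suff -> : @cons_tuple n @^-1` (uncons @^-1` (F k `*` G k)) = F k `*` G k.
  by rewrite product_measure1E// lte_mul_pinfty// ge0_fin_numE.
by apply/funext => p; rewrite -[in RHS](unconsK p).
Qed.

HB.instance Definition _ := Measure_isSigmaFinite.Build _ _ _ cons_measure
  cons_measure_sigma_finite.

End cons_measure.

Fixpoint lebesgue_Rn n : {sigma_finite_measure set (Rn R n) -> \bar R} :=
  match n with
  | 0%N => \d_([tuple] : Rn R 0)
  | n'.+1 => cons_measure (lebesgue_Rn n')
  end.

Lemma lebesgue_Rn_box n (A : 'I_n -> set (measurableTypeR R)) :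
  (forall i, measurable (A i)) ->
  lebesgue_Rn n [set x | forall i, A i (tnth x i)] =
  (\prod_(i < n) lebesgue_measure (A i))%E.
Proof.
elim: n A => [|n ih] A mA /=.
  rewrite big_ord0 diracE mem_set//.
  by case.
rewrite big_ord_recl -ih => [|i]; last exact: mA.
rewrite -product_measure1E//; last first.
  rewrite (_ : [set _ | _] = \bigcap_(i in [set: 'I_n])
      ((fun x : Rn R n => tnth x i) @^-1` A (lift ord0 i))); last first.
    by apply/seteqP; split => [x h i _|x h i]; exact: h.
  apply: fin_bigcap_measurable => // i _; rewrite -[X in measurable X]setTI.
  exact: (measurable_tnth i).
rewrite /cons_measure /pushforward; congr (_ _).
apply/seteqP; split => [[a t] /= h|[a t] /= [h0 h] i].
  split; first by have := h ord0.
  by move=> i; have := h (lift ord0 i); rewrite tnthS.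
by case: (unliftP ord0 i) => [j|] ->//; rewrite tnthS.
Qed.

End lebesgue_Rn.

Section euclidean.
Context {R : realType} {d : nat}.
Implicit Types x y : Rn R d.

Definition edot x y : R := \sum_(i < d) (tnth x i : R) * (tnth y i : R).

(* Euclidean norm (the library's norm on row vectors is the sup norm). *)
Definition enorm x : R := Num.sqrt (edot x x).

Definition esub x y : Rn R d := [tuple (tnth x i : R) - (tnth y i : R) | i < d].

End euclidean.

Local Open Scope complex_scope.

Definition expi {R : realType} (a : R) : R[i] := cos a +i* sin a.

Definition cintegral {disp} {T : measurableType disp} {R : realType}
    (mu : {measure set T -> \bar R}) (D : set T) (f : T -> R[i]) : R[i] :=
  (\int[mu]_(x in D) complex.Re (f x)) +i* (\int[mu]_(x in D) complex.Im (f x)).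

Section gaussian.
Context {disp} {Omega : measurableType disp} {R : realType}.
Variable P : probability Omega R.

(* [normal_prob m s] is the normal law of mean m and standard deviation s, for
   s != 0 only; the degenerate Gaussian law is a Dirac mass. *)
Definition gaussian_rv (X : Omega -> R) : Prop :=
  exists m s : R, forall A : set R, measurable A ->
    P (X @^-1` A) = if s == 0 then \d_m A else normal_prob m s A.

Definition centred_gaussian_process (I : Type) (T : set I)
    (X : I -> {RV P >-> R}) : Prop :=
  (forall (n : nat) (c : 'I_n -> R) (a : 'I_n -> I), (forall k, T (a k)) ->
     gaussian_rv (fun w => \sum_(k < n) c k * X (a k) w)) /\
  (forall a, T a -> ('E_P[X a] = 0)%E).

End gaussian.

Section wave_equation.
Context {R : realType} {d : nat}.
Variables beta theta : R.

Definition wave_kernel (t : R) (xi : Rn R d) : R :=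
  sin (t * Num.sqrt theta * enorm xi) / (Num.sqrt theta * enorm xi).

Definition wave_cov (t : R) (x : Rn R d) (s : R) (y : Rn R d) : R[i] :=
  (((2 * pi) ^+ d)^-1)%:C *
  cintegral (@lebesgue_measure R) `[0, Num.min t s] (fun r =>
    cintegral (lebesgue_Rn d) setT (fun xi =>
      expi (edot (esub x y) xi) *
      (wave_kernel (t - r) xi * wave_kernel (s - r) xi *
       (enorm xi) `^ (beta - d%:R))%:C)).

(* The solution of d_tt u = theta Delta u + W_beta on [0, +oo[ x R^d with zero
   initial data, W_beta having spectral density |xi|^(beta - d), characterised
   as the centred Gaussian process with covariance [wave_cov]; the values
   u t x for t < 0 are unconstrained. *)
Definition wave_solution {disp} {Omega : measurableType disp}
    (P : probability Omega R) (u : R -> Rn R d -> {RV P >-> R}) : Prop :=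
  centred_gaussian_process [set tx : R * Rn R d | 0 <= tx.1]
    (fun tx => u tx.1 tx.2) /\
  forall t x s y, 0 <= t -> 0 <= s ->
    ('E_P[fun w => (u t x w * u s y w)%R])%E \is a fin_num /\
    (fine ('E_P[fun w => (u t x w * u s y w)%R])%E)%:C = wave_cov t x s y.

End wave_equation.

Section temporal_increments.
Context {R : realType} {d : nat} {Omega : Type}.
Variables (u : R -> Rn R d -> Omega -> R) (delta : R) (x : Rn R d).

Definition obs_time (i : nat) : R := delta * i%:R.

(* meaningful for i >= 1 *)
Definition Ite (i : nat) (w : Omega) : R :=
  u (obs_time i.+1) x w + u (obs_time i.-1) x w - 2 * u (obs_time i) x w.

End temporal_increments.

Section remainder.
Context {R : realType}.

(* The value at 0 is 0 by the library's convention on division; [sinc] only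
   occurs below under integrals, where the point 0 is negligible. *)
Definition sinc (x : R) : R := sin x / x.

Definition rfun1 (i j : nat) (x : R) : R :=
  match `|i - j|%N with
  | 0%N => - sin (2 * i%:R * x)
  | 1%N => - sin ((i + j)%:R * x)
  | k => sin (k%:R * x) - sin ((i + j)%:R * x)
  end.

Definition rfun2 (i j : nat) (x : R) : R :=
  match `|i - j|%N with
  | 0%N => 4 * cos x - 2 * cos (2 * x) - 4 * sinc x + 2 * sinc (2 * x)
  | 1%N => - cos x + 7 / 2 * sinc x + 3 / 2 * sinc (3 * x) - 4 * sinc (2 * x)
  | _ => 0
  end.

Definition rfun3 (i j : nat) (x : R) : R :=
  match `|i - j|%N with
  | 0%N => 0
  | 1%N => - 8 * sin x ^+ 2 * sin (x / 2) ^+ 2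
  | k => - 8 * sin x * sin (x / 2) ^+ 2 * sin (k%:R * x)
  end.

Variables (d : nat) (beta theta : R).

Definition gte (w : Rn R d) : R :=
  sin (enorm w / 2) ^+ 4 * (enorm w) `^ (beta - d%:R - 2).

Definition Rem1 (i j : nat) : R :=
  4 / ((2 * pi) ^+ d * theta `^ (beta / 2)) *
  \int[lebesgue_Rn d]_w
    (sin (enorm w / 2) ^+ 4 * rfun1 i j (enorm w) *
     (enorm w) `^ (beta - d%:R - 3)).

Definition Rem23 (r : nat -> nat -> R -> R) (i j : nat) : R :=
  1 / (2 * (2 * pi) ^+ d * theta `^ (beta / 2)) *
  \int[lebesgue_Rn d]_w
    (r i j (enorm w) * (enorm w) `^ (beta - d%:R - 2)).

Definition Rem (i j : nat) : R :=
  Rem1 i j + Rem23 rfun2 i j + Rem23 rfun3 i j.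

End remainder.

(* Main.v *)
Require Import Defs.
From mathcomp Require Import ring lra.
From mathcomp Require Import measurable_realfun.

Set Implicit Arguments.
Unset Strict Implicit.
Unset Printing Implicit Defensive.
Import Order.TTheory GRing.Theory Num.Theory.
Import numFieldNormedType.Exports.

Local Open Scope classical_set_scope.
Local Open Scope ring_scope.

(** By Fubini and the explicit time integral of a product of two sines, the
    covariance of [u] at two times is the integral over frequencies of
    [wave_profile], and the substitution [w = sqrt theta * delta * xi] pulls the
    powers of [delta] and [theta] out. The second difference of [wave_profile]
    in both time indices is a trigonometric polynomial, in which the terms with
    the factor [minn i j] and those giving [Rem] can be read off. Every
    integrand except that of [rfun2] is dominated by a multiple, independent of
    [i] and [j], of [min(1, |w|^2) |w|^(beta - d - 2)], which is integrable
    because its integrals over dyadic shells form geometric series of ratio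
    [2^(-beta)] near the origin and [2^(beta - 2)] near infinity. The integrand
    of [rfun2] is then integrable as a combination of the others, and its
    integral takes at most three values, so it needs no estimate. *)

(** * Scaling of Lebesgue measure on R^n *)

Definition scale_Rn {R : realType} {d : nat} (c : R) (x : Rn R d) : Rn R d :=
  [tuple c * (tnth x i : R) | i < d].

Lemma enorm_scale_Rn {R : realType} {d : nat} (c : R) (x : Rn R d) : 0 <= c ->
  enorm (scale_Rn c x) = c * enorm x.
Proof.
move=> c0; rewrite /enorm.
suff -> : edot (scale_Rn c x) (scale_Rn c x) = c ^+ 2 * edot x x.
  by rewrite sqrtrM ?sqr_ge0// sqrtr_sqr ger0_norm.
rewrite /edot mulr_sumr; apply: eq_bigr => i _; rewrite tnth_mktuple.
by rewrite expr2 mulrACA.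
Qed.

Lemma enorm_ge0 {R : realType} {d : nat} (x : Rn R d) : 0 <= enorm x.
Proof. exact: sqrtr_ge0. Qed.

(** Puts each Euclidean ball inside the cube of the same radius, whose volume the product structure
    gives. *)
Lemma normr_tnth_le_enorm {R : realType} {d : nat} (x : Rn R d) i :
  `|(tnth x i : R)| <= enorm x.
Proof.
rewrite -sqrtr_sqr /enorm ler_sqrt; last first.
  by apply: sumr_ge0 => j _; rewrite -expr2 sqr_ge0.
rewrite /edot (bigD1 i)//= expr2 lerDl.
by apply: sumr_ge0 => j _; rewrite -expr2 sqr_ge0.
Qed.

Lemma measurable_enorm {R : realType} {d : nat} :
  measurable_fun [set: Rn R d] (@enorm R d).
Proof.
apply: (measurableT_comp (continuous_measurable_fun (@sqrt_continuous R))) => /=.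
apply: measurable_sum => i; apply: measurable_funM; exact: measurable_tnth.
Qed.

Lemma measurable_scale_Rn {R : realType} {d : nat} (c : R) :
  measurable_fun [set: Rn R d] (scale_Rn c).
Proof.
apply/measurable_fun_tnthP => i /=.
rewrite (_ : _ \o _ = (fun x : Rn R d => c * (tnth x i : R))).
  by apply: measurable_funM => //; exact: measurable_tnth.
by apply/funext => x /=; rewrite tnth_mktuple.
Qed.

(** The measure on [n.+1] coordinates is by construction the image of a product measure under
    [cons_tuple], so this is a change of variables followed by Tonelli. *)
Lemma ge0_integral_lebesgue_RnS {R : realType} n (f : Rn R n.+1 -> \bar R) :
  measurable_fun setT f -> (forall x, 0 <= f x)%E ->
  (\int[lebesgue_Rn n.+1]_x f x =
   \int[@lebesgue_measure R]_y \int[lebesgue_Rn n]_t f (cons_tuple (y, t)))%E.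
Proof.
move=> mf f0.
rewrite [LHS](_ : _ = (\int[pushforward (@lebesgue_measure R \x lebesgue_Rn n)%E
  (@cons_tuple R n)]_x f x)%E)//.
rewrite ge0_integral_pushforward//=; last exact: measurable_cons_tuple.
rewrite fubini_tonelli1//.
by apply: measurableT_comp mf _; exact: measurable_cons_tuple.
Qed.

(** Uniqueness of Lebesgue measure: [c] times the image measure under multiplication by [c] gives
    []a, b]] the mass [c (b / c - a / c) = b - a]. *)
Lemma lebesgue_measure_scale {R : realType} (c : R) (A : set (measurableTypeR R)) :
  0 < c -> measurable A ->
  (c%:E * lebesgue_measure ((fun x : measurableTypeR R => (c * x)%R) @^-1` A) =
   lebesgue_measure A)%E.
Proof.
move=> c0 mA; have ci0 : 0 <= c by exact: ltW.
have mM : measurable_fun setT (fun x : measurableTypeR R => (c * x : measurableTypeR R)).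
  by apply: measurable_funM.
pose nu : {measure set (measurableTypeR R) -> \bar R} := 
 mscale (NngNum ci0) (measure_function_pushforward__canonical__measure_function_Measure
  (@lebesgue_measure R) mM).
apply/esym.
apply: (@lebesgue_measure_unique R nu) => // X [[a b] _ <-] /=.
rewrite /nu /= /mscale/= /pushforward.
rewrite (_ : _ @^-1` _ = `]a / c, b / c]%classic); last first.
  apply/seteqP; split => x /=; rewrite !in_itv/= ltr_pdivrMr// ler_pdivlMr// mulrC//.
rewrite !lebesgue_measure_itv/= !lte_fin ltr_pM2r ?invr_gt0//.
case: ifPn => ab; last by rewrite mule0.
by rewrite -!EFinD -EFinM -mulrBl mulrC divfK// gt_eqF.
Qed.

Lemma ge0_integral_lebesgue_scale {R : realType} (c : R)
    (f : measurableTypeR R -> \bar R) :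
  0 < c -> measurable_fun setT f -> (forall x, 0 <= f x)%E ->
  (c%:E * \int[@lebesgue_measure R]_x f (c * x)%R =
   \int[@lebesgue_measure R]_x f x)%E.
Proof.
move=> c0 mf f0; have ci0 : 0 <= c by exact: ltW.
have mM : measurable_fun setT (fun x : measurableTypeR R => (c * x : measurableTypeR R)).
  by apply: measurable_funM.
rewrite [LHS](_ : _ = (c%:E * \int[pushforward (@lebesgue_measure R)
    (fun x : measurableTypeR R => (c * x)%R : measurableTypeR R)]_x f x)%E); last first.
  by rewrite ge0_integral_pushforward.
pose nu := measure_function_pushforward__canonical__measure_function_Measure
  (@lebesgue_measure R) mM.
have <- := @ge0_integral_mscale _ _ R nu setT measurableT (NngNum ci0) f mf (fun x _ => f0 x).
apply: eq_measure_integral => A mA _.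
exact: lebesgue_measure_scale.
Qed.

Lemma scale_cons_tuple {R : realType} n (c : R) (p : measurableTypeR R * Rn R n) :
  scale_Rn c (cons_tuple p) = cons_tuple (c * p.1, scale_Rn c p.2).
Proof.
apply: eq_from_tnth => i; rewrite tnth_mktuple.
by case: (unliftP ord0 i) => [j|] ->//; rewrite !tnthS tnth_mktuple.
Qed.

(** Induction on the dimension: the first coordinate contributes one factor [c], and the induction
    hypothesis on the other coordinates contributes [c ^+ n]. *)
Lemma ge0_integral_scale_Rn {R : realType} n (c : R) (f : Rn R n -> \bar R) :
  0 < c -> measurable_fun setT f -> (forall x, 0 <= f x)%E ->
  ((c ^+ n)%:E * \int[lebesgue_Rn n]_x f (scale_Rn c x) =
   \int[lebesgue_Rn n]_x f x)%E.
Proof.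
move=> c0; elim: n f => [|n ih] f mf f0.
  (* In dimension 0 the only point is the empty tuple, which scaling fixes. *)
  rewrite expr0 mul1e; apply: eq_integral => x _; congr f.
  by apply: eq_from_tnth => -[].
have mfs : measurable_fun setT (fun x => f (scale_Rn c x)).
  by apply: (measurableT_comp mf); exact: measurable_scale_Rn.
rewrite !ge0_integral_lebesgue_RnS//.
have mfp : measurable_fun setT (f \o @cons_tuple R n).
  by apply: (measurableT_comp mf); exact: measurable_cons_tuple.
have mF := @measurable_fun_fubini_tonelli_F _ _ _ _ _ (lebesgue_Rn n) _ mfp (fun x => f0 _).
have mg y : measurable_fun setT (fun t : Rn R n => f (cons_tuple (y, t))).
  by apply: (measurableT_comp mfp); exact: measurable_pair1.
rewrite -[RHS](ge0_integral_lebesgue_scale c0 mF); last first.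
  by move=> x; apply: integral_ge0 => y _; exact: f0.
rewrite exprS EFinM -muleA; congr (_ * _)%E.
have mfsp : measurable_fun setT (f \o (scale_Rn c \o @cons_tuple R n)).
  by apply: (measurableT_comp mfs); exact: measurable_cons_tuple.
rewrite -ge0_integralZl//; last 3 first.
- exact: (@measurable_fun_fubini_tonelli_F _ _ _ _ _ (lebesgue_Rn n) _ mfsp (fun x => f0 _)).
- by move=> x _; apply: integral_ge0.
- by rewrite lee_fin exprn_ge0// ltW.
apply: eq_integral => y _.
rewrite /fubini_F /= -[RHS](ih _ (mg _) (fun=> f0 _)); congr (_ * _)%E.
by apply: eq_integral => t _; rewrite scale_cons_tuple.
Qed.

(** * Integrability by dyadic shells *)

Lemma nneseries_geometric_lty {R : realType} (a z : R) (u : (\bar R)^nat) :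
  0 <= a -> 0 < z < 1 -> (forall k, 0 <= u k)%E ->
  (forall k, u k <= (a * z ^+ k)%:E)%E -> (\sum_(0 <= k <oo) u k < +oo)%E.
Proof.
move=> a0 /andP[z0 z1] u0 uz.
apply: (@le_lt_trans _ _ (a / (1 - z))%:E); last exact: ltry.
apply: lime_le; first by apply: is_cvg_nneseries.
apply: nearW => n.
apply: (@le_trans _ _ (\sum_(0 <= k < n) (a * z ^+ k)%:E)%E).
  by apply: lee_sum => k _; exact: uz.
rewrite sumEFin lee_fin.
by apply: (geometric_le_lim n a0 z0); rewrite ger0_norm// ltW.
Qed.

Lemma lebesgue_Rn_cube {R : realType} d (r : R) : 0 <= r ->
  lebesgue_Rn d [set x | forall i, `[- r, r]%classic (tnth x i)] =
  ((2 * r) ^+ d)%:E.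
Proof.
move=> r0; rewrite (@lebesgue_Rn_box R d (fun=> `[- r, r]%classic)) => [|i//].
rewrite (eq_bigr (fun=> (2 * r)%:E)) => [|i _].
  by rewrite prodEFin prodr_const card_ord.
rewrite lebesgue_measure_itv/= lte_fin; case: ifPn => rr.
  by rewrite -EFinD opprK mulr_natl.
by congr EFin; lra.
Qed.

Lemma measurable_cube {R : realType} d (r : R) :
  measurable [set x : Rn R d | forall i, `[- r, r]%classic (tnth x i)].
Proof.
rewrite (_ : [set _ | _] = \bigcap_(i in [set: 'I_d])
    ((fun x : Rn R d => tnth x i) @^-1` `[- r, r]%classic)); last first.
  by apply/seteqP; split => [x h i _|x h i]; exact: h.
apply: fin_bigcap_measurable => // i _; rewrite -[X in measurable X]setTI.
exact: (measurable_tnth i).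
Qed.

(** Where [f] does not vanish, a single term [c k] on the cube of half-side [r k] bounds it, so [f]
    lies below the series of these terms, whose integrals are at most [c k] times the volume of the
    cube. The alternative [f x = 0] serves for the origin, which lies in no dyadic shell. *)
Lemma integrable_shells {R : realType} d (D : set (Rn R d)) (f : Rn R d -> R)
    (c r : R^nat) (a z : R) :
  measurable D -> measurable_fun setT f -> (forall x, 0 <= f x) ->
  (forall k, 0 <= c k) -> (forall k, 0 <= r k) -> 0 <= a -> 0 < z < 1 ->
  (forall k, c k * (2 * r k) ^+ d <= a * z ^+ k) ->
  (forall x, D x -> f x = 0 \/ exists2 k, enorm x <= r k & f x <= c k) ->
  (lebesgue_Rn d).-integrable D (EFin \o f).
Proof.
move=> mD mf f0 c0 r0 a0 z01 cz cover.
pose B k := [set x : Rn R d | forall i, `[- r k, r k]%classic (tnth x i)].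
pose g k (x : Rn R d) : \bar R := (c k * \1_(B k) x)%:E.
have mB k : measurable (B k) by exact: measurable_cube.
have mg k : measurable_fun D (g k).
  by apply/measurable_EFinP; apply: measurable_funM => //; exact: measurable_indic.
have g0 k x : (0 <= g k x)%E by rewrite lee_fin mulr_ge0.
apply/integrableP; split; first by apply/measurable_EFinP; exact: measurable_funTS.
apply: (@le_lt_trans _ _ (\int[lebesgue_Rn d]_(x in D) \sum_(0 <= k <oo) g k x)%E).
  apply: ge0_le_integral => //.
  - by apply/measurable_EFinP; apply: measurableT_comp => //; exact: measurable_funTS.
  - apply: ge0_emeasurable_sum => //.
  - move=> x Dx /=; rewrite ger0_norm//.
    have [->|[k xr fc]] := cover x Dx; first by apply: nneseries_ge0 => *; exact: g0.
    (* The partial sum of length [k.+1] is the first one to contain the term of index [k]. *)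
    apply: le_trans (nneseries_lim_ge k.+1 (fun n _ _ => g0 n x)).
    rewrite big_nat_recr//=.
    apply: (@le_trans _ _ (g k x)); last by rewrite leeDr// sume_ge0.
    rewrite lee_fin indicE mem_set ?mulr1// => i /=; rewrite in_itv/= -ler_norml.
    exact: le_trans (normr_tnth_le_enorm x i) xr.
rewrite integral_nneseries//.
apply: (nneseries_geometric_lty a0 z01) => k.
  by apply: integral_ge0 => x _; exact: g0.
apply: le_trans (_ : (c k * (2 * r k) ^+ d)%:E <= _)%E; last by rewrite lee_fin.
rewrite /g; under eq_integral do rewrite EFinM.
rewrite ge0_integralZl//=; last 2 first.
- by apply/measurable_EFinP; exact: measurable_indic.
- by rewrite lee_fin.
rewrite integral_indic// EFinM lee_pmul//.
- by rewrite lee_fin.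
- rewrite -(lebesgue_Rn_cube d (r0 k)); apply: le_measure; rewrite ?inE//.
  - exact: measurableI.
  - exact: (mB k).
Qed.

Lemma le0_powR_anti {R : realType} (p x y : R) : p <= 0 -> 0 < x -> x <= y ->
  y `^ p <= x `^ p.
Proof.
move=> p0 x0 xy; have y0 : 0 < y by exact: lt_le_trans xy.
have -> : p = - `|p| by rewrite ler0_norm ?opprK.
rewrite !powRN lef_pV2 ?posrE ?powR_gt0//.
by apply: ge0_ler_powR; rewrite ?nnegrE// ltW.
Qed.

Lemma two_powR_gt1 {R : realType} (p : R) : 0 < p -> 1 < 2 `^ p.
Proof.
by move=> p0; have := @gt0_ltr_powR R p p0 1 2; rewrite powR1; apply; rewrite ?nnegrE ?ltr1n.
Qed.

Lemma exprn_powR {R : realType} (x p : R) k : 0 <= x ->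
  (x ^+ k) `^ p = (x `^ p) ^+ k.
Proof. 
by move=> x0; rewrite -(powR_mulrn k x0) -powRrM mulrC powRrM powR_mulrn// powR_ge0.
Qed.

Lemma exists_dyadic {R : realType} (y : R) : 1 <= y ->
  exists k, 2 ^+ k <= y <= 2 ^+ k.+1.
Proof.
move=> y1; have y0 : 0 <= y by exact: le_trans y1.
have ex : exists n, y < 2 ^+ n.
  exists (Num.trunc y).+1; apply: lt_trans (truncnS_gt y) _.
  by rewrite -natrX ltr_nat ltn_expl.
(* As [1 <= y], the least exponent is a successor [k.+1], and its minimality gives [2 ^+ k <= y]. *)
case: (ex_minnP ex) => -[|k] yk kmin.
  by move: yk; rewrite expr0 ltNge y1.
exists k; rewrite (ltW yk) andbT leNgt; apply/negP => /kmin.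
by rewrite ltnn.
Qed.

(** The minimum joins the two estimates available for the trigonometric factors: boundedness at high
    frequencies and quadratic vanishing at low ones, where the effective exponent becomes
    [beta - d]. *)
Definition majorant {R : realType} {d : nat} (beta : R) (x : Rn R d) : R :=
  Num.min 1 (enorm x ^+ 2) * enorm x `^ (beta - d%:R - 2).

Lemma majorant_ge0 {R : realType} {d : nat} (beta : R) (x : Rn R d) :
  0 <= majorant beta x.
Proof. by rewrite mulr_ge0 ?powR_ge0// le_min ler01 sqr_ge0. Qed.

Lemma measurable_enorm_powR {R : realType} {d : nat} (p : R) :
  measurable_fun [set: Rn R d] (fun x => enorm x `^ p).
Proof. apply: (measurableT_comp (measurable_powR p)); exact: measurable_enorm. Qed.

Lemma measurable_majorant {R : realType} {d : nat} (beta : R) :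
  measurable_fun [set: Rn R d] (@majorant R d beta).
Proof.
apply: measurable_funM; last exact: measurable_enorm_powR.
apply: measurable_minr => //; apply: measurable_funX; exact: measurable_enorm.
Qed.

(** The unit sphere separates two families of dyadic shells. The exponents [beta - d - 2] outside
    and [beta - d] inside are nonpositive, so on each shell the power is largest at the inner
    radius. *)
Lemma integrable_majorant {R : realType} {d : nat} (beta : R) :
  0 < beta -> beta < 2 -> beta <= d%:R ->
  (lebesgue_Rn d).-integrable [set: Rn R d] (EFin \o majorant beta).
Proof.
move=> b0 b2 bd.
pose D := [set x : Rn R d | 1 <= enorm x].
have mD : measurable D.
  rewrite (_ : D = setT `&` enorm @^-1` `[1, +oo[%classic).
    exact: measurable_enorm.
  by apply/seteqP; split => x; rewrite /D /= in_itv/= andbT => // -[].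
have two0 : 0 < 2 :> R by [].
have iD : (lebesgue_Rn d).-integrable D (EFin \o majorant beta).
  apply: (@integrable_shells R d D (majorant beta)
    (fun k => (2 ^+ k) `^ (beta - d%:R - 2)) (fun k => 2 ^+ k.+1)
    (4 ^+ d) (2 `^ (beta - 2))) => //.
  - exact: measurable_majorant.
  - exact: majorant_ge0.
  - rewrite powR_gt0//= -opprB powRN invf_lt1 ?powR_gt0//.
    by apply: two_powR_gt1; rewrite subr_gt0.
  (* The cube has side [4 * 2 ^+ k], so the factor [d] in the exponent cancels against its volume
     and leaves [4 ^+ d] times the [k]-th power of [2 ^ (beta - 2)]. *)
  - move=> k; rewrite (_ : 2 * _ = 4 * 2 ^+ k); last by rewrite exprS; ring.
    rewrite exprMn -(powR_mulrn d (exprn_ge0 k (ltW two0))) mulrCA -powRD; last first.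
      by rewrite lt0r_neq0 ?implybT// exprn_gt0.
    by rewrite addrAC subrK exprn_powR// ltW.
  - move=> x /= x1; right; have [k /andP[kx xk]] := exists_dyadic x1.
    exists k => //; apply: (@le_trans _ _ (1 * enorm x `^ (beta - d%:R - 2))).
      by rewrite ler_wpM2r ?powR_ge0// ge_min lexx.
    rewrite mul1r le0_powR_anti ?exprn_gt0//; lra.
have iC : (lebesgue_Rn d).-integrable (~` D) (EFin \o majorant beta).
  apply: (@integrable_shells R d (~` D) (majorant beta)
    (fun k => (2^-1 ^+ k.+1) `^ (beta - d%:R)) (fun k => 2^-1 ^+ k)
    (4 ^+ d * 2^-1 `^ beta) (2^-1 `^ beta)) => //.
  - exact: measurableC.
  - exact: measurable_majorant.
  - exact: majorant_ge0.
  - rewrite powR_gt0 ?invr_gt0//= -powR_inv1// -powRrM mulN1r powRN.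
    by rewrite invf_lt1 ?powR_gt0//; exact: two_powR_gt1.
  (* Same cancellation with inner radius [2 ^ (- k - 1)]; the shift by one in the exponent is the
     extra factor [2 ^ (- beta)] of the constant. *)
  - move=> k; have w0 : 0 < 2^-1 ^+ k.+1 :> R by rewrite exprn_gt0// invr_gt0.
    rewrite (_ : 2 * _ = 4 * 2^-1 ^+ k.+1); last first.
      by rewrite exprS mulrA; congr (_ * _); field.
    rewrite exprMn -(powR_mulrn d (ltW w0)) mulrCA -powRD; last first.
      by rewrite lt0r_neq0 ?implybT.
    by rewrite subrK exprn_powR ?invr_ge0// exprS mulrA.
  - move=> x /= x1; have := enorm_ge0 x; rewrite le_eqVlt => /predU1P[x0|x0].
      by left; rewrite /majorant -x0 expr0n/= min_r// mul0r.
    (* Inside the unit ball it is the inverse of the norm that is located between two powers of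
       2. *)
    right; have /exists_dyadic[k /andP[kx xk]] : 1 <= (enorm x)^-1.
      by rewrite invf_ge1//; apply/ltW; rewrite ltNge; apply/negP.
    have xk' : 2^-1 ^+ k.+1 <= enorm x.
      by rewrite exprVn -[leRHS]invrK lef_pV2 ?posrE ?invr_gt0 ?exprn_gt0.
    have kx' : enorm x <= 2^-1 ^+ k.
      by rewrite exprVn -[leLHS]invrK lef_pV2 ?posrE ?invr_gt0 ?exprn_gt0.
    exists k => //; apply: (@le_trans _ _ (enorm x `^ (beta - d%:R))).
      rewrite /majorant.
      apply: (@le_trans _ _ (enorm x ^+ 2 * enorm x `^ (beta - d%:R - 2))).
        by rewrite ler_wpM2r ?powR_ge0// ge_min lexx orbT.
      rewrite -powR_mulrn ?enorm_ge0// -powRD; last by rewrite lt0r_neq0 ?implybT.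
      by rewrite addrC subrK.
    by apply: le0_powR_anti => //; lra.
rewrite (_ : _ \o _ = ((EFin \o majorant beta) \_ D \+ (EFin \o majorant beta) \_ (~` D))%E).
  apply: integrableD => //.
  - exact/(integrable_mkcond _ mD).
  - exact/(integrable_mkcond _ (measurableC mD)).
apply/funext => x; rewrite /= !patchE in_setC.
by case: (x \in D); rewrite /= ?adde0 ?add0e.
Qed.

(** * Scaling of integrals of integrable functions *)

Lemma integrable_scale_Rn {R : realType} n (c : R) (f : Rn R n -> R) :
  0 < c -> (lebesgue_Rn n).-integrable setT (EFin \o f) ->
  (lebesgue_Rn n).-integrable setT (EFin \o (fun x => f (scale_Rn c x))).
Proof.
move=> c0 /integrableP[/measurable_EFinP mf fi].
have mfs : measurable_fun setT (fun x => f (scale_Rn c x)).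
  by apply: (measurableT_comp mf); exact: measurable_scale_Rn.
apply/integrableP; split; first exact/measurable_EFinP.
have mF : measurable_fun setT (fun x : Rn R n => `|(f x)%:E|%E).
  by apply/measurable_EFinP; apply: measurableT_comp.
have := ge0_integral_scale_Rn c0 mF (fun x => abse_ge0 _).
move=> E; move: fi; rewrite -E/= => fi.
have ci0 : (0 < (c ^+ n)^-1%:E)%E by rewrite lte_fin invr_gt0 exprn_gt0.
have : ((c ^+ n)^-1%:E * ((c ^+ n)%:E *
   \int[lebesgue_Rn n]_x `|(f (scale_Rn c x))%:E|) < +oo)%E.
  by rewrite lte_mul_pinfty// ltW.
by rewrite muleA -EFinM mulVf ?mul1e// expf_neq0// gt_eqF.
Qed.

Lemma Rintegral_scale_Rn {R : realType} n (c : R) (f : Rn R n -> R) :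
  0 < c -> (lebesgue_Rn n).-integrable setT (EFin \o f) ->
  c ^+ n * \int[lebesgue_Rn n]_x f (scale_Rn c x) = \int[lebesgue_Rn n]_x f x.
Proof.
move=> c0 fi; have fsi := integrable_scale_Rn c0 fi.
have mf : measurable_fun setT (EFin \o f) by case/integrableP: fi.
apply: EFin_inj.
rewrite EFinM /Rintegral !fineK; [|exact: integrable_fin_num..].
rewrite [RHS]integralE.
rewrite -(ge0_integral_scale_Rn c0 (measurable_funepos mf))//.
rewrite -(ge0_integral_scale_Rn c0 (measurable_funeneg mf))//.
rewrite -muleBr//.
  congr mule; rewrite [LHS](integralE _ _ (EFin \o (fun x => f (scale_Rn c x)))).
  by congr (_ - _)%E; apply: eq_integral => x _; rewrite ?funeposE ?funenegE.
(* Distributing [c ^+ n] over positive minus negative part requires the difference to be defined;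
   the integral of the negative part is finite. *)
rewrite fin_num_adde_defl// fin_numN (eq_integral
  (EFin \o (fun x => f (scale_Rn c x)))^\-%E) => [|x _].
  exact: (integrable_neg_fin_num measurableT fsi).
by rewrite !funenegE.
Qed.

(** * Time integral of a product of sines, and exchange of integrals *)

Lemma continuous_sin_time {R : realType} (k a : R) :
  continuous (fun r : R => sin ((a - r) * k)).
Proof.
move=> r; apply: (@continuous_comp _ _ _ (fun r : R => (a - r) * k) sin).
  by apply: cvgMl; apply: cvgB; [exact: cvg_cst|exact: cvg_id].
exact: continuous_sin.
Qed.

Lemma integral_sin_sin {R : realType} (k a b T : R) : 0 <= T -> k != 0 ->
  \int[lebesgue_measure]_(r in `[0, T]) (sin ((a - r) * k) * sin ((b - r) * k)) =
  (T * cos ((a - b) * k) -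
   (sin ((a + b) * k) - sin ((a + b - 2 * T) * k)) / (2 * k)) / 2.
Proof.
(* The case [T = 0] is treated apart because the fundamental theorem is applied on a nondegenerate
   interval. *)
move=> T0 k0; move: T0; rewrite le_eqVlt => /predU1P[<-|T0].
  by rewrite set_itv1 Rintegral_set1 mulr0 subr0 subrr mul0r mul0r subr0 mul0r.
(* Antiderivative read off from [2 sin A sin B = cos (A - B) - cos (A + B)], where [A - B] is
   independent of [r]. *)
pose F (r : R) := (r * cos ((a - b) * k) + sin ((a + b - 2 * r) * k) / (2 * k)) / 2.
pose f (r : R) := sin ((a - r) * k) * sin ((b - r) * k).
have dF (r : R) : is_derive r (1 : R) F (f r).
  apply: is_derive_eq.
  rewrite /GRing.scale/= /f.
  have -> : (a - b) * k = (a - r) * k - (b - r) * k by ring.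
  have -> : (a + b - 2 * r) * k = (a - r) * k + (b - r) * k by ring.
  rewrite cosB cosD; field.
  by rewrite k0.
have cF : continuous F.
  by move=> r; apply: differentiable_continuous; apply/derivable1_diffP; case: (dF r).
have cf : continuous f by move=> r; apply: cvgM; exact: continuous_sin_time.
rewrite /Rintegral (@continuous_FTC2 R f F 0 T T0).
- rewrite -EFinB/= /F mul0r add0r mulr0 subr0 -mulrBl; congr (_ / _); lra.
- exact: continuous_subspaceT.
- split.
  + by move=> x _; case: (dF x).
  + by apply: cvg_at_right_filter; exact: cF.
  + by apply: cvg_at_left_filter; exact: cF.
- by move=> x _; rewrite derive1E; case: (dF x).
Qed.

Lemma norm_sin_le {R : realType} (x : R) : `|sin x| <= `|x|.
Proof.
wlog x0 : x / 0 <= x.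
  move=> H; have [/H//|/ltW x0] := leP 0 x.
  by have := H (- x); rewrite sinN !normrN; apply; rewrite oppr_ge0.
move: x0; rewrite le_eqVlt => /predU1P[<-|x0]; first by rewrite sin0.
have [c _] := @MVT R sin cos 0 x x0 (fun x _ => is_derive_sin x)
  (continuous_subspaceT (@continuous_sin R)).
rewrite sin0 !subr0 => ->; rewrite normrM.
by rewrite ler_piMl// cos_max.
Qed.

(** The bound [g] does not depend on [y], so the double integral of [|q|] is at most [m2 D] times
    the integral of [|g|], and Fubini applies. The integrability of the inner integral is kept
    because it later yields that of the frequency integrand. *)
Lemma dominated_Rintegral_swap {d1 d2} {T1 : measurableType d1}
    {T2 : measurableType d2} {R : realType}
    (m1 : {sigma_finite_measure set T1 -> \bar R})
    (m2 : {sigma_finite_measure set T2 -> \bar R})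
    (D : set T2) (q : T1 -> T2 -> R) (g : T1 -> R) :
  measurable D -> (m2 D < +oo)%E ->
  measurable_fun setT (fun z : T1 * T2 => q z.1 z.2) ->
  m1.-integrable setT (EFin \o g) ->
  (forall x y, D y -> `|q x y| <= g x) ->
  m1.-integrable setT (EFin \o (fun x => \int[m2]_(y in D) q x y)) /\
  \int[m2]_(y in D) \int[m1]_x q x y = \int[m1]_x \int[m2]_(y in D) q x y.
Proof.
move=> mD m2D mq ig qg.
have mg : measurable_fun setT g by case/integrableP: ig => /measurable_EFinP.
have mq1 y : measurable_fun setT (fun x => q x y).
  exact: (measurableT_comp mq (measurable_pair2 y)).
have mq2 x : measurable_fun setT (q x).
  exact: (measurableT_comp mq (measurable_pair1 x)).
(* The domain [D] is absorbed into an indicator, so that Fubini is used on the full product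
   space. *)
pose F (z : T1 * T2) : \bar R := (q z.1 z.2 * \1_D z.2)%:E.
have mF : measurable_fun setT F.
  apply/measurable_EFinP; apply: measurable_funM => //.
  by apply: (measurableT_comp (measurable_indic mD)); exact: measurable_snd.
have mkD (f : T2 -> R) :
    (\int[m2]_(y in D) (f y)%:E = \int[m2]_y (f y * \1_D y)%:E)%E.
  rewrite integral_mkcond; apply: eq_integral => y _.
  by rewrite patchE indicE; case: (y \in D); rewrite ?mulr1 ?mulr0.
have iq2 x : m2.-integrable D (EFin \o q x).
  have gx : m2.-integrable D (EFin \o cst (g x)).
    apply/integrableP; split; first exact/measurable_EFinP.
    rewrite (eq_integral (cst `|(g x)%:E|%E))// integral_cst//.
    by rewrite lte_mul_pinfty// abse_ge0.
  apply: (le_integrable mD _ _ gx).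
    by apply/measurable_EFinP; exact: measurable_funTS.
  by move=> y Dy /=; rewrite lee_fin (le_trans (qg x y Dy))// ler_norm.
have iq1 y : D y -> m1.-integrable setT (EFin \o q^~ y).
  move=> Dy; apply: (le_integrable measurableT _ _ ig).
    exact/measurable_EFinP.
  by move=> x _ /=; rewrite lee_fin (le_trans (qg x y Dy))// ler_norm.
have iF : (m1 \x m2)%E.-integrable setT F.
  apply/integrable12ltyP => //.
  apply: (@le_lt_trans _ _ (\int[m1]_x (m2 D * `|(g x)%:E|))%E).
    apply: ge0_le_integral => //.
    - by move=> x _; apply: integral_ge0.
    - apply: (measurable_fun_fubini_tonelli_F (fun z => `|F z|%E)) => //.
      exact: measurableT_comp.
    - by apply: measurable_funeM; apply/measurable_EFinP; exact: measurableT_comp.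
    - move=> x _; have -> : (\int[m2]_y `|F (x, y)| =
          \int[m2]_(y in D) `|q x y|%:E)%E.
        rewrite mkD; apply: eq_integral => y _; rewrite /F/= normrM.
        by rewrite [`|\1_D y|]ger0_norm.
      rewrite muleC -integral_cst//; apply: ge0_le_integral => //.
      + by apply/measurable_EFinP; apply: measurableT_comp => //; exact: measurable_funTS.
      + by move=> y Dy /=; rewrite lee_fin (le_trans (qg x y Dy))// ler_norm.
  rewrite ge0_integralZl//; last by apply/measurable_EFinP; exact: measurableT_comp.
  rewrite -[m2 D]fineK ?ge0_fin_numE//; apply: lte_mul_pinfty => //.
  - by rewrite lee_fin fine_ge0.
  - by case/integrableP: ig.
have FE x : fubini_F m2 F x = (\int[m2]_(y in D) q x y)%:E.
  rewrite /fubini_F /F/= -mkD /Rintegral fineK//.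
  exact: (integrable_fin_num mD (iq2 x)).
have GE y : fubini_G m1 F y = ((\int[m1]_x q x y) * \1_D y)%:E.
  rewrite /fubini_G /F/= indicE; case: (boolP (y \in D)) => [|_] /=.
    rewrite inE => Dy; rewrite mulr1 /Rintegral fineK; last first.
      exact: (integrable_fin_num measurableT (iq1 y Dy)).
    by apply: eq_integral => x _; rewrite mulr1.
  by rewrite mulr0 integral0_eq// => x _; rewrite mulr0.
split.
  rewrite (_ : EFin \o _ = fubini_F m2 F); last by apply/funext => x; rewrite FE.
  exact: integrable_fubini_F.
have := integral12_prod_meas1 iF; rewrite -(integral21_prod_meas1 iF) => E.
rewrite /Rintegral; congr fine; rewrite -/(Rintegral _ _ _).
transitivity (\int[m2]_y fubini_G m1 F y)%E.
  rewrite (mkD (fun y => \int[m1]_x q x y)).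
  by apply: eq_integral => y _; rewrite GE.
by rewrite -E; apply: eq_integral => x _; rewrite FE.
Qed.

(** * Covariance of the solution *)

(* [wave_profile a b y] is the integral of [sin ((a - r) * y) * sin ((b - r) * y)]
   over [r] in [[0, min a b]]. *)
Definition wave_profile {R : realType} (a b y : R) : R :=
  (Num.min a b * cos ((a - b) * y) -
   (sin ((a + b) * y) - sin (`|a - b| * y)) / (2 * y)) / 2.

(** Homogeneity that turns a common rescaling of the two times into a rescaling of the frequency. *)
Lemma wave_profile_scale {R : realType} (c a b y : R) : 0 < c ->
  wave_profile (c * a) (c * b) y = c * wave_profile a b (c * y).
Proof.
move=> c0; rewrite /wave_profile.
have -> : Num.min (c * a) (c * b) = c * Num.min a b by rewrite minr_pMr// ltW.
rewrite -mulrBr normrM (gtr0_norm c0) -mulrDr.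
rewrite ![c * _ * y]mulrAC ![c * y * _]mulrC.
(* With [1 / 0 = 0], the quotient drops out on both sides at [y = 0]. *)
have [->|y0] := eqVneq y 0; first by rewrite !mulr0 !invr0; ring.
by field; rewrite y0 gt_eqF.
Qed.

(** Integrand of [wave_cov] at equal space points, where the phase is 1 and only a real factor
    remains. *)
Definition wave_integrand {R : realType} {d : nat} (beta theta t s : R)
    (xi : Rn R d) (r : R) : R :=
  wave_kernel theta (t - r) xi * wave_kernel theta (s - r) xi *
  enorm xi `^ (beta - d%:R).

(** Low-frequency bound: [|sin z| <= |z|] cancels the denominator, and a zero denominator makes the
    kernel 0. *)
Lemma wave_kernel_le_time {R : realType} {d : nat} (theta a : R) (xi : Rn R d) :
  `|wave_kernel theta a xi| <= `|a|.
Proof.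
rewrite /wave_kernel -mulrA normrM normfV.
have [->|k0] := eqVneq (Num.sqrt theta * enorm xi) 0.
  by rewrite normr0 invr0 mulr0.
rewrite ler_pdivrMr ?normr_gt0// -normrM; exact: norm_sin_le.
Qed.

(** High-frequency bound, from [|sin| <= 1]; the product form stays valid at [xi = 0]. *)
Lemma wave_kernel_le_freq {R : realType} {d : nat} (theta a : R) (xi : Rn R d) :
  0 < theta ->
  `|wave_kernel theta a xi| * enorm xi <= (Num.sqrt theta)^-1.
Proof.
move=> theta0; have kappa0 : 0 < Num.sqrt theta by rewrite sqrtr_gt0.
rewrite /wave_kernel; have := enorm_ge0 xi; rewrite le_eqVlt => /predU1P[<-|x0].
  by rewrite mulr0 invr_ge0 sqrtr_ge0.
rewrite normrM normfV normrM (gtr0_norm x0) (gtr0_norm kappa0).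
rewrite invfM mulrA divfK ?gt_eqF//.
by rewrite ler_piMl ?invr_ge0 ?sqrtr_ge0// sin_max.
Qed.

Lemma powR_enorm_sub2 {R : realType} {d : nat} (beta : R) (xi : Rn R d) :
  0 < enorm xi ->
  enorm xi `^ (beta - d%:R) = enorm xi ^+ 2 * enorm xi `^ (beta - d%:R - 2).
Proof.
move=> x0; rewrite -powR_mulrn ?enorm_ge0// -powRD.
  by rewrite (addrC 2) subrK.
by rewrite lt0r_neq0 ?implybT.
Qed.

(** The two kernel bounds match the two branches of the minimum in [majorant]: the product of
    kernels is at most [t * s], and times [|xi| ^ 2] it is at most [1 / theta]. The constant is free
    of [r], as the exchange of integrals needs. *)
Lemma wave_integrand_le {R : realType} {d : nat} (beta theta t s r : R)
    (xi : Rn R d) : 0 < theta -> 0 <= r <= Num.min t s ->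
  `|wave_integrand beta theta t s xi r| <=
  Num.max (t * s) (Num.sqrt theta ^- 2) * majorant beta xi.
Proof.
move=> theta0; rewrite le_min => /andP[r0 /andP[rt rs]].
have := enorm_ge0 xi; rewrite le_eqVlt => /predU1P[x0|x0].
  rewrite /wave_integrand /wave_kernel -x0 !mulr0 invr0 !mulr0 !mul0r normr0.
  rewrite mulr_ge0 ?majorant_ge0//.
  by rewrite le_max orbC invr_ge0 exprn_ge0 ?sqrtr_ge0.
rewrite /wave_integrand (powR_enorm_sub2 _ x0) /majorant mulrA normrM.
rewrite (ger0_norm (powR_ge0 _ _)) mulrA ler_wpM2r ?powR_ge0//.
set K1 := wave_kernel _ (t - r) _; set K2 := wave_kernel _ _ _.
have K1t : `|K1| <= t.
  by apply: le_trans (wave_kernel_le_time _ _ _) _; rewrite ger0_norm; lra.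
have K2s : `|K2| <= s.
  by apply: le_trans (wave_kernel_le_time _ _ _) _; rewrite ger0_norm; lra.
have KK1 : `|K1 * K2| <= t * s by rewrite normrM ler_pM.
have KK2 : `|K1 * K2| * enorm xi ^+ 2 <= Num.sqrt theta ^- 2.
  rewrite normrM expr2 mulrACA -exprVn expr2.
  by rewrite ler_pM ?mulr_ge0 ?enorm_ge0// wave_kernel_le_freq.
rewrite normrM (ger0_norm (sqr_ge0 (enorm xi))).
have M0 : 0 <= Num.max (t * s) (Num.sqrt theta ^- 2).
  by rewrite le_max orbC invr_ge0 exprn_ge0 ?sqrtr_ge0.
have [le1|lt1] := leP 1 (enorm xi ^+ 2).
  by rewrite mulr1 (le_trans KK2)// le_max lexx orbT.
by rewrite ler_wpM2r ?sqr_ge0// (le_trans KK1)// le_max lexx.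
Qed.

(** The two denominators of the kernels supply [theta * |xi| ^ 2], which lowers the exponent from
    [beta - d] to [beta - d - 2]. *)
Lemma wave_time_integral {R : realType} {d : nat} (beta theta t s : R)
    (xi : Rn R d) : beta < 2 -> beta <= d%:R -> 0 < theta -> 0 <= t -> 0 <= s ->
  \int[lebesgue_measure]_(r in `[0, Num.min t s]) wave_integrand beta theta t s xi r =
  wave_profile t s (Num.sqrt theta * enorm xi) *
    enorm xi `^ (beta - d%:R - 2) / Num.sqrt theta ^+ 2.
Proof.
move=> beta2 betad theta0 t0 s0; pose kappa := Num.sqrt theta.
have kappa0 : 0 < kappa by rewrite sqrtr_gt0.
have m0 : 0 <= Num.min t s by rewrite le_min t0.
have := enorm_ge0 xi; rewrite le_eqVlt => /predU1P[x0|x0].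
  (* At [xi = 0] both sides vanish by convention: the kernels divide by 0, and the power of 0 has a
     negative exponent. *)
  rewrite -x0 powR0; last by apply/negP => /eqP; lra.
  rewrite mulr0 mul0r; under eq_Rintegral => r _.
    rewrite /wave_integrand /wave_kernel -x0 !mulr0 invr0 !mulr0 !mul0r; over.
  by rewrite Rintegral_cst ?mul0r.
pose k := kappa * enorm xi.
have k0 : k != 0 by rewrite mulf_neq0 ?gt_eqF.
transitivity (\int[lebesgue_measure]_(r in `[0, Num.min t s])
   ((enorm xi `^ (beta - d%:R - 2) / kappa ^+ 2) *
    (sin ((t - r) * k) * sin ((s - r) * k)))).
  apply: eq_Rintegral => r _; rewrite /wave_integrand /wave_kernel (powR_enorm_sub2 _ x0).
  rewrite -!(mulrA _ kappa) -/kappa -/k; rewrite /k; field.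
  by rewrite !gt_eqF.
rewrite RintegralZl//; last first.
  apply: continuous_compact_integrable; first exact: segment_compact.
  by apply: continuous_subspaceT => r; apply: cvgM; exact: continuous_sin_time.
rewrite integral_sin_sin//.
(* The value of the antiderivative at the upper end point is the source of [|a - b|] in
   [wave_profile]. *)
have -> : t + s - 2 * Num.min t s = `|t - s|.
  have [ts|ts] := leP t s; [rewrite ler0_norm|rewrite gtr0_norm]; lra.
by rewrite /wave_profile -/kappa -/k; ring.
Qed.

Lemma measurable_wave_integrand {R : realType} {d : nat} (beta theta t s : R) :
  measurable_fun setT (fun z : Rn R d * measurableTypeR R =>
    wave_integrand beta theta t s z.1 z.2).
Proof.
have mE : measurable_fun setT (fun z : Rn R d * measurableTypeR R => enorm z.1).
  exact: (measurableT_comp measurable_enorm measurable_fst).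
have mK (a : R) : measurable_fun setT (fun z : Rn R d * measurableTypeR R =>
    wave_kernel theta (a - z.2) z.1).
  (* The quotient is written with a power of exponent -1, legitimate for a nonnegative base, so that
     measurability of [powR] applies. *)
  rewrite (_ : (fun _ => _) = fun z : Rn R d * measurableTypeR R =>
      sin ((a - z.2) * Num.sqrt theta * enorm z.1) *
      (Num.sqrt theta * enorm z.1) `^ (- 1)); last first.
    by apply/funext => z; rewrite powR_inv1// mulr_ge0 ?sqrtr_ge0.
  apply: measurable_funM.
    apply: (measurableT_comp (continuous_measurable_fun (@continuous_sin R))).
    apply: measurable_funM => //; apply: measurable_funM => //.
    by apply: measurable_funB => //; exact: measurable_snd.
  by apply: (measurableT_comp (measurable_powR _)); exact: measurable_funM.
apply: measurable_funM; first exact: measurable_funM.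
exact: (measurableT_comp (measurable_powR _) mE).
Qed.

Lemma scale_RnK {R : realType} {d : nat} (c : R) : c != 0 ->
  cancel (@scale_Rn R d c^-1) (scale_Rn c).
Proof.
move=> c0 x; apply: eq_from_tnth => i; rewrite !tnth_mktuple.
by rewrite mulVKf.
Qed.

Lemma cintegral_real {disp} {T : measurableType disp} {R : realType}
    (mu : {measure set T -> \bar R}) (D : set T) (f : T -> R) :
  measurable D ->
  cintegral mu D (fun x => (f x)%:C%C) = (\int[mu]_(x in D) f x)%:C%C.
Proof. by move=> mD; rewrite /cintegral/= Rintegral_cst// mul0r. Qed.

Lemma wave_cov_diag {R : realType} {d : nat} (beta theta t s : R) (x : Rn R d) :
  wave_cov beta theta t x s x =
  (((2 * pi) ^+ d)^-1 * \int[lebesgue_measure]_(r in `[0, Num.min t s])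
     \int[lebesgue_Rn d]_xi wave_integrand beta theta t s xi r)%:C%C.
Proof.
rewrite /wave_cov rmorphM/=; congr (_ * _).
rewrite -cintegral_real//; congr cintegral; apply/funext => r.
rewrite -cintegral_real//; congr cintegral; apply/funext => xi.
have -> : edot (esub x x) xi = 0.
  by apply: big1 => i _; rewrite tnth_mktuple subrr mul0r.
by rewrite /expi sin0 cos0 mul1r.
Qed.

(** Fubini gives the formula and the integrability together: the time integral is a constant times
    the rescaled integrand, and the scaling is then undone. *)
Lemma wave_cov_obs {R : realType} {d : nat} (beta theta delta p q : R)
    (x : Rn R d) :
  0 < beta -> beta < 2 -> beta <= d%:R -> 0 < theta -> 0 < delta ->
  0 <= p -> 0 <= q ->
  (lebesgue_Rn d).-integrable setT
    (EFin \o (fun w => wave_profile p q (enorm w) *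
                       enorm w `^ (beta - d%:R - 2))) /\
  wave_cov beta theta (delta * p) x (delta * q) x =
  (delta `^ (3 - beta) / ((2 * pi) ^+ d * theta `^ (beta / 2)) *
   \int[lebesgue_Rn d]_w (wave_profile p q (enorm w) *
     enorm w `^ (beta - d%:R - 2)))%:C%C.
Proof.
move=> b0 b2 bd th0 de0 p0 q0.
set e := beta - d%:R - 2; set kappa := Num.sqrt theta.
have ka0 : 0 < kappa by rewrite sqrtr_gt0.
(* This scale absorbs both the [delta] of the observation times and the [sqrt theta] of the
   kernel. *)
pose c := delta * kappa; have c0 : 0 < c by rewrite mulr_gt0.
set f := fun w : Rn R d => wave_profile p q (enorm w) * enorm w `^ e.
set t := delta * p; set s := delta * q.
have t0 : 0 <= t by rewrite mulr_ge0// ltW.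
have s0 : 0 <= s by rewrite mulr_ge0// ltW.
have itv_lty (m : R) : (@lebesgue_measure R (`[0%R, m]%classic : set R) < +oo)%E.
  by rewrite lebesgue_measure_itv/=; case: ifP => _; rewrite ?ltry// -EFinD ltry.
have [] := @dominated_Rintegral_swap _ _ (Rn R d) (measurableTypeR R) R
  (lebesgue_Rn d) lebesgue_measure `[0, Num.min t s]%classic
  (wave_integrand beta theta t s)
  (fun xi => Num.max (t * s) (Num.sqrt theta ^- 2) * majorant beta xi).
- exact: measurable_itv.
- exact: itv_lty.
- exact: measurable_wave_integrand.
- rewrite (_ : _ \o _ = fun xi => ((Num.max (t * s) (Num.sqrt theta ^- 2))%:E *
    (majorant beta xi)%:E)%E)//.
  by apply: integrableZl => //; exact: integrable_majorant.
- by move=> xi r /=; rewrite in_itv/= => ?; exact: wave_integrand_le.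
have E xi : \int[lebesgue_measure]_(r in `[0, Num.min t s])
    wave_integrand beta theta t s xi r =
    delta / kappa ^+ 2 * c `^ (- e) * f (scale_Rn c xi).
  rewrite wave_time_integral// wave_profile_scale// -/kappa (mulrA delta kappa) -/c.
  rewrite /f enorm_scale_Rn ?(ltW c0)// powRM ?(ltW c0) ?enorm_ge0// powRN.
  move: (wave_profile _ _ _) => W; rewrite -/e; field.
  by rewrite !gt_eqF ?powR_gt0.
under eq_fun do rewrite E.
set A := delta / kappa ^+ 2 * c `^ (- e).
have A0 : A != 0 by rewrite /A !mulf_neq0 ?invr_eq0 ?expf_neq0 ?gt_eqF ?powR_gt0.
move=> iAf swap.
have ifs : (lebesgue_Rn d).-integrable setT (EFin \o (fun xi => f (scale_Rn c xi))).
  rewrite (_ : _ \o _ = fun xi => (A^-1%:E * (A * f (scale_Rn c xi))%:E)%E).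
    exact: integrableZl.
  by apply/funext => xi; rewrite -EFinM mulKf.
have iF : (lebesgue_Rn d).-integrable setT (EFin \o f).
  have ci0 : 0 < c^-1 by rewrite invr_gt0.
  have := integrable_scale_Rn ci0 ifs.
  by under eq_fun do rewrite (scale_RnK (lt0r_neq0 c0)).
split=> //.
rewrite wave_cov_diag swap RintegralZl//; congr (_ %:C)%C.
rewrite -(Rintegral_scale_Rn c0 iF) [LHS]mulrA [RHS]mulrA; congr (_ * _).
have -> : theta `^ (beta / 2) = kappa `^ beta.
  by rewrite mulrC powRrM powR12_sqrt// ltW.
have sE (y : R) : 0 < y -> y `^ (2 - beta) = y ^+ 2 / y `^ beta.
  move=> y0; rewrite powRB; last by rewrite lt0r_neq0 ?implybT.
  by rewrite powR_mulrn// ltW.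
have -> : delta `^ (3 - beta) = delta * (delta ^+ 2 / delta `^ beta).
  rewrite -sE// -[X in X * _]powRr1 ?ltW// -powRD ?lt0r_neq0 ?implybT//.
  by congr (_ `^ _); ring.
(* As [- e = d + (2 - beta)], the part [c ^+ d] is the Jacobian of the scaling. The rest gives
   [delta ^ (2 - beta)], completed to [3 - beta] by the factor [delta] of [A], and
   [kappa ^ (2 - beta)], which divided by [kappa ^ 2] leaves [theta ^ (- beta / 2)]. *)
have cE : c `^ (- e) = c ^+ d * ((delta ^+ 2 / delta `^ beta) *
    (kappa ^+ 2 / kappa `^ beta)).
  rewrite -!sE// -powRM ?ltW// -/c -powR_mulrn ?(ltW c0)//.
  rewrite -powRD ?lt0r_neq0 ?implybT//; congr (_ `^ _).
  by rewrite /e; ring.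
rewrite /A cE.
have pi0 : (2 * pi : R) ^+ d != 0.
  by rewrite expf_neq0// mulf_neq0// gt_eqF ?pi_gt0.
by field; rewrite pi0 !gt_eqF ?powR_gt0.
Qed.

(** * Second differences *)

(** Same shape as [Ite], predecessor included, so that an increment is convertible to [diff2] of the
    observations. *)
Definition diff2 {R : pzRingType} (f : nat -> R) (i : nat) : R :=
  f i.+1 + f i.-1 - 2 * f i.

Lemma wave_profileC {R : realType} (a b y : R) :
  wave_profile a b y = wave_profile b a y.
Proof.
rewrite /wave_profile minC distrC (addrC a b).
by have -> : (a - b) * y = - ((b - a) * y); [ring|rewrite cosN].
Qed.

(** The arguments [D] and [S] are free up to an equation, so that each use can impose the normal
    form wanted for the addition formulas. *)
Lemma wave_profile_le {R : realType} (a b y D S : R) :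
  b <= a -> (a - b) * y = D -> (a + b) * y = S ->
  wave_profile a b y = (b * cos D - (sin S - sin D) / (2 * y)) / 2.
Proof.
move=> ba <- <-; rewrite /wave_profile min_r//.
by rewrite ger0_norm// subr_ge0.
Qed.

Lemma sin_half_sqr {R : realType} (y : R) : sin (y / 2) ^+ 2 = (1 - cos y) / 2.
Proof.
have -> : cos y = cos ((y / 2) *+ 2) by rewrite -mulr_natr divfK.
by rewrite cos_mulr2n cos2sin2; field.
Qed.

Lemma cos2E {R : realType} (y : R) : cos (2 * y) = 2 * cos y ^+ 2 - 1.
Proof. by rewrite mulr_natl cos_mulr2n mulr_natl. Qed.

Lemma sin2E {R : realType} (y : R) : sin (2 * y) = 2 * sin y * cos y.
Proof. by rewrite mulr_natl sin_mulr2n; ring. Qed.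

Lemma rfun1C {R : realType} (i j : nat) (y : R) : rfun1 i j y = rfun1 j i y.
Proof.
have [->//|ij] := eqVneq i j.
rewrite /rfun1 (distnC j) (addnC j).
by case E : `|i - j|%N => // ; move: ij; rewrite -distn_eq0 E.
Qed.

(** Nine values of [wave_profile] are expanded by the addition formulas around [(i - j) y] and
    [(i + j) y], which leaves a rational identity in sines and cosines. The order of the shifted
    indices decides each minimum, hence the three cases on [|i - j|]. *)
Lemma wave_profile_diff2 {R : realType} (i j : nat) (y : R) :
  (0 < i)%N -> (0 < j)%N -> 0 < y ->
  diff2 (fun p => diff2 (fun q => wave_profile p%:R q%:R y) j) i =
  8 * (minn i j)%:R * (cos ((i%:R - j%:R) * y) * sin (y / 2) ^+ 4) +
  4 * (sin (y / 2) ^+ 4 * rfun1 i j y / y) +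
  2^-1 * rfun2 i j y + 2^-1 * rfun3 i j y.
Proof.
wlog ji : i j / (j <= i)%N.
  move=> H i0 j0 y0; have /orP[ji|ij] := leq_total j i; first exact: H.
  have := H j i ij j0 i0 y0.
  have -> : diff2 (fun p => diff2 (fun q => wave_profile p%:R q%:R y) i) j =
     diff2 (fun p => diff2 (fun q => wave_profile p%:R q%:R y) j) i :> R.
    rewrite /diff2 !(wave_profileC j.+1%:R) !(wave_profileC j.-1%:R).
    by rewrite !(wave_profileC j%:R); ring.
  move=> ->; rewrite minnC -(opprB i%:R) mulNr cosN.
  by rewrite rfun1C /rfun2 /rfun3 (distnC j).
move=> i0 j0 y0; have yn0 : y != 0 by rewrite gt_eqF.
have [k ki] : exists k, i = (j + k)%N by exists (i - j)%N; rewrite subnKC.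
have dk : `|i - j|%N = k by rewrite ki distnEl ?leq_addr// addKn.
rewrite (minn_idPr ji) (exprM (sin (y / 2)) 2 2).
rewrite /rfun1 /rfun2 /rfun3 dk /diff2.
have iP : i.-1%:R = i%:R + (-1) :> R by rewrite -subn1 natrB.
have jP : j.-1%:R = j%:R + (-1) :> R by rewrite -subn1 natrB.
rewrite iP jP -(natr1 i) -(natr1 j) natrD.
have iE : i%:R = j%:R + k%:R :> R by rewrite ki natrD.
(* The index [j] now becomes an arbitrary real [J]: only the gap [k] matters for the identity. *)
clear iP jP ki dk ji i0 j0; rewrite iE; move: (j%:R) => J {iE}.
have W := @wave_profile_le R.
have sq := sin_half_sqr y; have s2 := sin2cos2 y.
case: k => [|[|k]].
(* Diagonal case: the pairs whose first index is the smaller are swapped before [W] is applied. *)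
- rewrite mulr0n !addr0 subrr mul0r cos0.
  rewrite (wave_profileC (J - 1) (J + 1)) (wave_profileC (J - 1) J).
  rewrite (wave_profileC J (J + 1)).
  rewrite (W (J + 1) (J + 1) y 0 (2 * J * y + 2 * y)); [|lra|ring|ring].
  rewrite (W (J + 1) (J - 1) y (2 * y) (2 * J * y)); [|lra|ring|ring].
  rewrite (W (J + 1) J y y (2 * J * y + y)); [|lra|ring|ring].
  rewrite (W (J - 1) (J - 1) y 0 (2 * J * y - 2 * y)); [|lra|ring|ring].
  rewrite (W J (J - 1) y y (2 * J * y - y)); [|lra|ring|ring].
  rewrite (W J J y 0 (2 * J * y)); [|lra|ring|ring].
  set B := 2 * J * y; rewrite /sinc !(sinD, sinN, cosN, sin0, cos0) !cos2E !sin2E sq.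
  by field.
(* Gap 1: only the pair formed by [i - 1 = J] and [j + 1 = J + 1] is out of order. *)
- rewrite (wave_profileC (J + 1 - 1) (J + 1)) (addrK 1 J) [J + 1 - J]addrAC.
  rewrite subrr add0r mul1r.
  rewrite (W (J + 1 + 1) (J + 1) y y ((2 * J + 1) * y + 2 * y)); [|lra|ring|ring].
  rewrite (W (J + 1 + 1) (J - 1) y (3 * y) ((2 * J + 1) * y)); [|lra|ring|ring].
  rewrite (W (J + 1 + 1) J y (2 * y) ((2 * J + 1) * y + y)); [|lra|ring|ring].
  rewrite (W (J + 1) (J + 1) y 0 ((2 * J + 1) * y + y)); [|lra|ring|ring].
  rewrite (W (J + 1) (J - 1) y (2 * y) ((2 * J + 1) * y - y)); [|lra|ring|ring].
  rewrite (W (J + 1) J y y ((2 * J + 1) * y)); [|lra|ring|ring].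
  rewrite (W J (J - 1) y y ((2 * J + 1) * y - 2 * y)); [|lra|ring|ring].
  rewrite (W J J y 0 ((2 * J + 1) * y - y)); [|lra|ring|ring].
  have -> : (J + 1 + J) * y = (2 * J + 1) * y by ring.
  have c3 : cos (3 * y) = 4 * cos y ^+ 3 - 3 * cos y.
    have -> : 3 * y = 2 * y + y by ring.
    rewrite cosD cos2E sin2E (_ : 2 * sin y * cos y * sin y = 2 * cos y * sin y ^+ 2).
      by rewrite s2; ring.
    by ring.
  set B := (2 * J + 1) * y; rewrite /sinc c3 s2.
  rewrite !(sinD B) !(sinN, cosN, sin0, cos0) !cos2E !sin2E sq.
  by field.
(* From gap 2 on, [j + 1 <= i - 1], so the minimum is always the index on the side of [j]. *)
- have : 2 <= k.+2%:R :> R by rewrite ler_nat.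
  move: k.+2%:R => K K2; have -> : J + K - J = K by ring.
  rewrite (W (J + K + 1) (J + 1) y (K * y) ((2 * J + K) * y + 2 * y)); [|lra|ring|ring].
  rewrite (W (J + K + 1) (J - 1) y (K * y + 2 * y) ((2 * J + K) * y)); [|lra|ring|ring].
  rewrite (W (J + K + 1) J y (K * y + y) ((2 * J + K) * y + y)); [|lra|ring|ring].
  rewrite (W (J + K - 1) (J + 1) y (K * y - 2 * y) ((2 * J + K) * y)); [|lra|ring|ring].
  rewrite (W (J + K - 1) (J - 1) y (K * y) ((2 * J + K) * y - 2 * y)); [|lra|ring|ring].
  rewrite (W (J + K - 1) J y (K * y - y) ((2 * J + K) * y - y)); [|lra|ring|ring].
  rewrite (W (J + K) (J + 1) y (K * y - y) ((2 * J + K) * y + y)); [|lra|ring|ring].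
  rewrite (W (J + K) (J - 1) y (K * y + y) ((2 * J + K) * y - y)); [|lra|ring|ring].
  rewrite (W (J + K) J y (K * y) ((2 * J + K) * y)); [|lra|ring|ring].
  have -> : (J + K + J) * y = (2 * J + K) * y by ring.
  set A := K * y; set B := (2 * J + K) * y.
  rewrite !(cosD, sinD, cosN, sinN) cos2E sin2E sq.
  by field.
Qed.

(** * Covariances and integrals of second differences *)

Lemma Lfun2_of_sqr_fin {disp} {T : measurableType disp} {R : realType}
    (mu : {measure set T -> \bar R}) (X : T -> R) :
  measurable_fun setT X -> (\int[mu]_w (X w * X w)%:E)%E \is a fin_num ->
  X \in Lfun mu 2%:E.
Proof.
move=> mX fX; rewrite inE; apply/andP; split; rewrite inE//=.
rewrite /finite_norm unlock /Lnorm poweR_lty//=.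
rewrite (eq_integral (fun w => (X w * X w)%:E)).
  by rewrite ltey_eq fX.
by move=> w _; rewrite powR_mulrn// -normrX ger0_norm ?sqr_ge0// expr2.
Qed.

Lemma covariance_diff2l {disp} {T : measurableType disp} {R : realType}
    (P : probability T R) (X : nat -> T -> R) (Y : T -> R) (b : nat -> R) i :
  (forall p, X p \in Lfun P 2%:E) -> Y \in Lfun P 2%:E ->
  (forall p, covariance P (X p) Y = (b p)%:E) ->
  covariance P (fun w => diff2 (X ^~ w) i) Y = (diff2 b i)%:E.
Proof.
move=> X2 Y2 Xb.
have Pfin : P setT \is a fin_num := fin_num_measure P _ measurableT.
rewrite (_ : (fun _ => _) = ((X i.+1 \+ X i.-1) \- (2 \o* X i))%R); last first.
  by apply/funext => w; rewrite /diff2/= [X i w * _]mulrC.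
rewrite covarianceBl//; last 2 first.
- by apply: rpredD => //; rewrite lee1n.
- by apply: Lfun_scale; rewrite ?ler1n.
rewrite covarianceDl// covarianceZl//; last 3 first.
- exact: (Lfun_subset12 Pfin (X2 _)).
- exact: (Lfun_subset12 Pfin Y2).
- exact: (Lfun2_mul_Lfun1 (X2 _) Y2).
by rewrite !Xb.
Qed.

Lemma Lfun2_diff2 {disp} {T : measurableType disp} {R : realType}
    (mu : {measure set T -> \bar R}) (X : nat -> T -> R) i :
  (forall p, X p \in Lfun mu 2%:E) -> (fun w => diff2 (X ^~ w) i) \in Lfun mu 2%:E.
Proof.
move=> X2.
rewrite (_ : (fun _ => _) = ((X i.+1 \+ X i.-1) \- (2 \o* X i))%R); last first.
  by apply/funext => w; rewrite /diff2/= [X i w * _]mulrC.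
apply: rpredB => [|le12|le12]; first by rewrite lee1n.
- by apply: rpredD; exact: X2.
- by apply: Lfun_scale; rewrite ?ler1n.
Qed.

Lemma covariance_diff2 {disp} {T : measurableType disp} {R : realType}
    (P : probability T R) (X : nat -> T -> R) (b : nat -> nat -> R) i j :
  (forall p, X p \in Lfun P 2%:E) ->
  (forall p q, covariance P (X p) (X q) = (b p q)%:E) ->
  covariance P (fun w => diff2 (X ^~ w) i) (fun w => diff2 (X ^~ w) j) =
  (diff2 (fun p => diff2 (b p) j) i)%:E.
Proof.
move=> X2 Xb; apply: covariance_diff2l => // [|p]; first exact: Lfun2_diff2.
rewrite covarianceC; apply: covariance_diff2l => // q.
by rewrite covarianceC.
Qed.

(** The sum stays under [EFin], the form in which the real-valued integral is later split; likewise
    for the next two lemmas. *)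
Lemma EFin_integrableD {disp} {T : measurableType disp} {R : realType}
    (mu : {measure set T -> \bar R}) (f g : T -> R) :
  mu.-integrable setT (EFin \o f) -> mu.-integrable setT (EFin \o g) ->
  mu.-integrable setT (EFin \o (fun x => f x + g x)).
Proof. by move=> fi gi; have := integrableD measurableT fi gi. Qed.

Lemma EFin_integrableZl {disp} {T : measurableType disp} {R : realType}
    (mu : {measure set T -> \bar R}) (c : R) (f : T -> R) :
  mu.-integrable setT (EFin \o f) ->
  mu.-integrable setT (EFin \o (fun x => c * f x)).
Proof. by move=> fi; have := integrableZl measurableT c fi. Qed.

Lemma EFin_integrableB {disp} {T : measurableType disp} {R : realType}
    (mu : {measure set T -> \bar R}) (f g : T -> R) :
  mu.-integrable setT (EFin \o f) -> mu.-integrable setT (EFin \o g) ->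
  mu.-integrable setT (EFin \o (fun x => f x - g x)).
Proof. by move=> fi gi; have := integrableB measurableT fi gi. Qed.

Lemma integrable_diff2 {disp} {T : measurableType disp} {R : realType}
    (mu : {measure set T -> \bar R}) (f : nat -> T -> R) i :
  (forall p, mu.-integrable setT (EFin \o f p)) ->
  mu.-integrable setT (EFin \o (fun w => diff2 (f ^~ w) i)).
Proof.
move=> fi.
apply: EFin_integrableB; first exact: EFin_integrableD.
exact: EFin_integrableZl.
Qed.

Lemma Rintegral_diff2 {disp} {T : measurableType disp} {R : realType}
    (mu : {measure set T -> \bar R}) (f : nat -> T -> R) i :
  (forall p, mu.-integrable setT (EFin \o f p)) ->
  \int[mu]_w diff2 (f ^~ w) i = diff2 (fun p => \int[mu]_w f p w) i.
Proof.
move=> fi; rewrite /diff2 RintegralB//.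
- by rewrite RintegralD// RintegralZl.
- exact: EFin_integrableD.
- exact: EFin_integrableZl.
Qed.

(** * Dominated terms and boundedness of the remainder *)

(** Source of the cut-off in [majorant], from [|sin| <= 1] and [|sin z| <= |z|]. *)
Lemma sqr_sin_half_le {R : realType} (y : R) :
  sin (y / 2) ^+ 2 <= Num.min 1 (y ^+ 2).
Proof.
rewrite le_min -[sin _ ^+ 2]real_normK ?num_real// -[y ^+ 2]real_normK ?num_real//.
rewrite exprn_ile1 ?sin_max//= ler_pXn2r ?nnegrE// (le_trans (norm_sin_le _))//.
by rewrite normrM normfV normr_nat ler_piMr// invf_le1// ler1n.
Qed.

(** The bound on the integral sees [f] only through [C], which is how uniformity in [i] and [j] is
    obtained. *)
Lemma integrable_le_majorant {R : realType} {d : nat} (beta C : R)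
    (f : Rn R d -> R) : 0 < beta -> beta < 2 -> beta <= d%:R ->
  measurable_fun setT f -> (forall x, `|f x| <= C * majorant beta x) ->
  (lebesgue_Rn d).-integrable setT (EFin \o f) /\
  `|\int[lebesgue_Rn d]_x f x| <= C * \int[lebesgue_Rn d]_x majorant beta x.
Proof.
move=> b0 b2 bd mf fC; have ih := @integrable_majorant R d beta b0 b2 bd.
have iCh := EFin_integrableZl C ih.
have fi : (lebesgue_Rn d).-integrable setT (EFin \o f).
  apply: (le_integrable measurableT _ _ iCh); first exact/measurable_EFinP.
  by move=> x _ /=; rewrite lee_fin (le_trans (fC x))// ler_norm.
split=> //; rewrite -RintegralZl//.
apply: (le_trans (le_normr_Rintegral measurableT fi)).
apply: le_Rintegral => //.
by have := integrable_norm fi.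
Qed.

Lemma measurable_sinM {R : realType} (a : R) :
  measurable_fun [set: R] (fun y : R => sin (a * y)).
Proof.
apply: (measurableT_comp (continuous_measurable_fun (@continuous_sin R))).
exact: measurable_funM.
Qed.

Lemma measurable_sin_half {R : realType} n :
  measurable_fun [set: R] (fun y : R => sin (y / 2) ^+ n).
Proof.
apply: measurable_funX; under eq_fun do rewrite mulrC; exact: measurable_sinM.
Qed.

Lemma measurable_rfun1 {R : realType} i j : measurable_fun [set: R] (@rfun1 R i j).
Proof.
have mN a : measurable_fun [set: R] (fun y => - sin (a * y)).
  by apply: measurableT_comp => //; exact: measurable_sinM.
rewrite /rfun1; case: `|i - j|%N => [|[|k]]; [exact: mN..|].
by apply: measurable_funB; exact: measurable_sinM.
Qed.

Lemma measurable_rfun3 {R : realType} i j : measurable_fun [set: R] (@rfun3 R i j).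
Proof.
have ms : measurable_fun setT (@sin R).
  exact: (continuous_measurable_fun (@continuous_sin R)).
rewrite /rfun3; case: `|i - j|%N => [|[|k]] //.
  apply: measurable_funM; last exact: measurable_sin_half.
  by apply: measurable_funM => //; apply: measurable_funX.
apply: measurable_funM; last exact: measurable_sinM.
by apply: measurable_funM; [exact: measurable_funM|exact: measurable_sin_half].
Qed.

Lemma norm_rfun1_le {R : realType} i j (y : R) : `|rfun1 i j y| <= 2.
Proof.
have one x : `|sin x| <= 2 :> R by rewrite (le_trans (sin_max x))// ler1n.
rewrite /rfun1; case: `|i - j|%N => [|[|k]]; rewrite ?normrN ?one//.
by rewrite (le_trans (ler_normB _ _))// (_ : 2 = 1 + 1)// lerD// sin_max.
Qed.

(** The factor [sin (y / 2) ^+ 2] is kept, since it compensates the singularity at the origin. *)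
Lemma norm_rfun3_le {R : realType} i j (y : R) :
  `|rfun3 i j y| <= 8 * sin (y / 2) ^+ 2.
Proof.
rewrite /rfun3; case: `|i - j|%N => [|[|k]].
- by rewrite normr0 mulr_ge0// sqr_ge0.
- rewrite normrM (ger0_norm (sqr_ge0 (sin (y / 2)))) ler_wpM2r ?sqr_ge0//.
  by rewrite mulNr normrN normrM normr_nat ler_piMr// normrX exprn_ile1 ?sin_max.
- rewrite normrM -[leRHS]mulr1 ler_pM ?sin_max//.
  rewrite normrM (ger0_norm (sqr_ge0 (sin (y / 2)))) ler_wpM2r ?sqr_ge0//.
  by rewrite mulNr normrN normrM normr_nat ler_piMr// sin_max.
Qed.

Section dominated_terms.
Context {R : realType} {d : nat}.
Variables (beta : R) (i j : nat).
Implicit Types w : Rn R d.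

Lemma norm_cos_gte_le w :
  `|cos ((i%:R - j%:R) * enorm w) * gte beta w| <= 1 * majorant beta w.
Proof.
rewrite mul1r /gte /majorant mulrA normrM (ger0_norm (powR_ge0 _ _)).
rewrite ler_wpM2r ?powR_ge0// normrM (exprM _ 2 2) (ger0_norm (sqr_ge0 _)).
apply: le_trans (sqr_sin_half_le _).
have s1 : sin (enorm w / 2) ^+ 2 <= 1.
  by apply: le_trans (sqr_sin_half_le _) _; rewrite ge_min lexx.
rewrite (le_trans (ler_piMl _ (cos_max _))) ?sqr_ge0//.
by rewrite expr2 ler_piMl// sqr_ge0.
Qed.

(** Of the four sine factors, two give the cut-off, one is bounded by 1, and one absorbs the
    additional [1 / |w|]: [2 |sin (y / 2)| <= y], where the 2 is the bound on [rfun1]. *)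
Lemma norm_rem1_le w : beta < 2 -> beta <= d%:R ->
  `|sin (enorm w / 2) ^+ 4 * rfun1 i j (enorm w) *
    enorm w `^ (beta - d%:R - 3)| <= 1 * majorant beta w.
Proof.
move=> b2 bd; rewrite mul1r; have := enorm_ge0 w.
rewrite le_eqVlt => /predU1P[w0|w0].
  rewrite -w0 powR0 ?mulr0 ?normr0 ?majorant_ge0//; apply/negP => /eqP; lra.
set y := enorm w in w0 *.
have -> : y `^ (beta - d%:R - 3) = y `^ (beta - d%:R - 2) / y.
  rewrite -powR_inv1 ?ltW// -powRD ?lt0r_neq0 ?implybT//.
  by congr (_ `^ _); ring.
rewrite /majorant -/y [_ `^ _ / y]mulrC mulrA normrM (ger0_norm (powR_ge0 _ _)).
rewrite ler_wpM2r ?powR_ge0//.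
apply: le_trans (sqr_sin_half_le _).
rewrite !normrM normfV (gtr0_norm w0) ler_pdivrMr//.
have s1 : `|sin (y / 2)| <= 1 := sin_max _.
have s2 : `|sin (y / 2)| * 2 <= y.
  by have := norm_sin_le (y / 2); rewrite normrM normfV normr_nat (gtr0_norm w0); lra.
rewrite -[leRHS](_ : `|sin (y / 2)| ^+ 2 * y = _); last first.
  by rewrite real_normK ?num_real.
move: `|sin (y / 2)| (normr_ge0 (sin (y / 2))) s1 s2 => a a0 a1 a2.
rewrite mulrA -expr2 -mulrA ler_wpM2l ?sqr_ge0//.
apply: le_trans a2; rewrite ler_pM ?mulr_ge0 ?norm_rfun1_le//.
by rewrite ler_piMl.
Qed.

Lemma norm_rem3_le w :
  `|rfun3 i j (enorm w) * enorm w `^ (beta - d%:R - 2)| <= 8 * majorant beta w.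
Proof.
rewrite normrM (ger0_norm (powR_ge0 _ _)) /majorant mulrA ler_wpM2r ?powR_ge0//.
by rewrite (le_trans (norm_rfun3_le _ _ _))// ler_wpM2l// sqr_sin_half_le.
Qed.

End dominated_terms.

Lemma integrable_cos_gte {R : realType} {d : nat} (beta : R) (i j : nat) :
  0 < beta -> beta < 2 -> beta <= d%:R ->
  (lebesgue_Rn d).-integrable setT
    (EFin \o (fun w => cos ((i%:R - j%:R) * enorm w) * gte beta w)).
Proof.
move=> b0 b2 bd; have [] // := @integrable_le_majorant R d beta 1 _ b0 b2 bd _
  (norm_cos_gte_le beta i j).
have mE := @measurable_enorm R d.
apply: measurable_funM.
  apply: (measurableT_comp (continuous_measurable_fun (@continuous_cos R))).
  exact: measurable_funM.
apply: measurable_funM; last exact: measurable_enorm_powR.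
exact: (measurableT_comp (measurable_sin_half 4) mE).
Qed.

Lemma integrable_rem1 {R : realType} {d : nat} (beta : R) (i j : nat) :
  0 < beta -> beta < 2 -> beta <= d%:R ->
  let f (w : Rn R d) := sin (enorm w / 2) ^+ 4 * rfun1 i j (enorm w) *
    enorm w `^ (beta - d%:R - 3) in
  (lebesgue_Rn d).-integrable setT (EFin \o f) /\
  `|\int[lebesgue_Rn d]_w f w| <= 1 * \int[lebesgue_Rn d]_w majorant beta w.
Proof.
move=> b0 b2 bd; apply: integrable_le_majorant => // [|w]; last exact: norm_rem1_le.
have mE := @measurable_enorm R d.
apply: measurable_funM; last exact: measurable_enorm_powR.
apply: measurable_funM; first exact: (measurableT_comp (measurable_sin_half 4) mE).
exact: (measurableT_comp (measurable_rfun1 i j) mE).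
Qed.

Lemma integrable_rem3 {R : realType} {d : nat} (beta : R) (i j : nat) :
  0 < beta -> beta < 2 -> beta <= d%:R ->
  let f (w : Rn R d) := rfun3 i j (enorm w) * enorm w `^ (beta - d%:R - 2) in
  (lebesgue_Rn d).-integrable setT (EFin \o f) /\
  `|\int[lebesgue_Rn d]_w f w| <= 8 * \int[lebesgue_Rn d]_w majorant beta w.
Proof.
move=> b0 b2 bd; apply: integrable_le_majorant => // [|w]; last exact: norm_rem3_le.
apply: measurable_funM; last exact: measurable_enorm_powR.
exact: (measurableT_comp (measurable_rfun3 i j) (@measurable_enorm R d)).
Qed.

Lemma Rem23_rfun2_le {R : realType} d (beta theta : R) (i j : nat) :
  `|Rem23 d beta theta rfun2 i j| <=
  \sum_(k < 3) `|Rem23 d beta theta rfun2 k 0|.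
Proof.
(* [rfun2] depends on [|i - j|] alone and vanishes from 2 on, so the pair [(k, 0)], with the gap
   truncated at 2, represents [(i, j)]. *)
pose k := if (`|i - j| < 3)%N then `|i - j|%N else 2%N.
have k3 : (k < 3)%N by rewrite /k; case: ifP.
have -> : Rem23 d beta theta rfun2 i j = Rem23 d beta theta rfun2 k 0.
  rewrite /Rem23; congr (_ * _); apply: eq_Rintegral => w _; congr (_ * _).
  rewrite /rfun2 /k; case: `|i - j|%N => [|[|[|n]]] //.
rewrite (bigD1 (Ordinal k3))//= lerDl.
by apply: sumr_ge0 => l _.
Qed.

Lemma bounded_Rem {R : realType} d (beta theta : R) :
  0 < beta -> beta < 2 -> beta <= d%:R ->
  exists C : R, forall i j : nat, `|Rem d beta theta i j| <= C.
Proof.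
move=> b0 b2 bd.
pose c1 := 4 / ((2 * pi) ^+ d * theta `^ (beta / 2)).
pose c3 := 1 / (2 * (2 * pi) ^+ d * theta `^ (beta / 2)).
pose I := \int[lebesgue_Rn d]_w majorant beta w.
exists (`|c1| * (1 * I) + \sum_(k < 3) `|Rem23 d beta theta rfun2 k 0| +
        `|c3| * (8 * I)) => i j.
have [_ H1] := @integrable_rem1 R d beta i j b0 b2 bd.
have [_ H3] := @integrable_rem3 R d beta i j b0 b2 bd.
rewrite /Rem (le_trans (ler_normD _ _))// lerD//.
  rewrite (le_trans (ler_normD _ _))// lerD//; last exact: Rem23_rfun2_le.
  by rewrite /Rem1 normrM ler_wpM2l.
by rewrite /Rem23 normrM ler_wpM2l.
Qed.

(** * Integrated identity and conclusion *)

Lemma Rintegral_wave_diff2 {R : realType} {d : nat} (beta : R) (i j : nat) :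
  0 < beta -> beta < 2 -> beta <= d%:R ->
  (0 < i)%N -> (0 < j)%N ->
  diff2 (fun p => diff2 (fun q => \int[lebesgue_Rn d]_w
    (wave_profile p%:R q%:R (enorm w) * enorm w `^ (beta - d%:R - 2))) j) i =
  8 * (minn i j)%:R * \int[lebesgue_Rn d]_w
     (cos ((i%:R - j%:R) * enorm w) * gte beta w) +
  4 * \int[lebesgue_Rn d]_w (sin (enorm w / 2) ^+ 4 * rfun1 i j (enorm w) *
     enorm w `^ (beta - d%:R - 3)) +
  2^-1 * \int[lebesgue_Rn d]_w
    (rfun2 i j (enorm w) * enorm w `^ (beta - d%:R - 2)) +
  2^-1 * \int[lebesgue_Rn d]_w
    (rfun3 i j (enorm w) * enorm w `^ (beta - d%:R - 2)).
Proof.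
move=> b0 b2 bd i0 j0.
pose F p q (w : Rn R d) :=
  wave_profile p%:R q%:R (enorm w) * enorm w `^ (beta - d%:R - 2).
have iF p q : (lebesgue_Rn d).-integrable setT (EFin \o F p q).
  (* Only the integrability is extracted; its statement contains neither [delta] nor [theta] nor the
     space point, so they are set to 1, 1 and the origin. *)
  exact: (@wave_cov_obs R d beta 1 1 p%:R q%:R [tuple 0 | _ < d] b0 b2 bd ltr01
    ltr01 (ler0n _ _) (ler0n _ _)).1.
have i0f := @integrable_cos_gte R d beta i j b0 b2 bd.
have [i1f _] := @integrable_rem1 R d beta i j b0 b2 bd.
have [i3f _] := @integrable_rem3 R d beta i j b0 b2 bd.
set f0 := fun w : Rn R d => cos _ * _ in i0f *.
set f1 := fun w : Rn R d => _ * _ `^ (beta - d%:R - 3) in i1f *.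
set f3 := fun w : Rn R d => rfun3 _ _ _ * _ in i3f *.
pose f2 (w : Rn R d) := rfun2 i j (enorm w) * enorm w `^ (beta - d%:R - 2).
pose S w := diff2 (fun p => diff2 (fun q => F p q w) j) i.
have iFj p := integrable_diff2 j (iF p).
have iS : (lebesgue_Rn d).-integrable setT (EFin \o S).
  exact: (integrable_diff2 i iFj).
transitivity (\int[lebesgue_Rn d]_w S w).
  rewrite /S (Rintegral_diff2 i iFj); congr (diff2 _ i); apply/funext => p.
  by rewrite (Rintegral_diff2 j (iF p)).
have SE w : S w = 8 * (minn i j)%:R * f0 w + 4 * f1 w + 2^-1 * f2 w + 2^-1 * f3 w.
  have -> : S w = diff2 (fun p => diff2 (fun q =>
      wave_profile p%:R q%:R (enorm w)) j) i * enorm w `^ (beta - d%:R - 2).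
    by rewrite /S /F /diff2; ring.
  have := enorm_ge0 w; rewrite le_eqVlt => /predU1P[w0|w0].
    (* At the origin every power has a nonzero exponent, hence is 0 by convention, and both sides
       vanish. *)
    rewrite /f0 /f1 /f2 /f3 /gte -w0 !powR0 ?mulr0 ?addr0//;
    by apply/negP => /eqP; lra.
  rewrite wave_profile_diff2// /f0 /f1 /f2 /f3 /gte.
  have -> : enorm w `^ (beta - d%:R - 3) = enorm w `^ (beta - d%:R - 2) / enorm w.
    rewrite -powR_inv1 ?enorm_ge0// -powRD ?lt0r_neq0 ?implybT//.
    by congr (_ `^ _); ring.
  by field; rewrite gt_eqF.
have i0c := EFin_integrableZl (8 * (minn i j)%:R) i0f.
have i1c := EFin_integrableZl 4 i1f.
have i3c := EFin_integrableZl 2^-1 i3f.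
(* The identity [SE] is solved for the term in [rfun2], whose integrability follows by
   subtraction. *)
have i2c : (lebesgue_Rn d).-integrable setT (EFin \o (fun w => 2^-1 * f2 w)).
  have := EFin_integrableB (EFin_integrableB (EFin_integrableB iS i0c) i1c) i3c.
  by congr (_.-integrable _ _); apply/funext => w /=; rewrite SE; congr EFin; ring.
have i2f : (lebesgue_Rn d).-integrable setT (EFin \o f2).
  have := EFin_integrableZl 2 i2c.
  by congr (_.-integrable _ _); apply/funext => w /=; congr EFin; field.
under eq_Rintegral => w _ do rewrite SE.
have i01 := EFin_integrableD i0c i1c.
have i012 := EFin_integrableD i01 i2c.
by rewrite !RintegralD// !RintegralZl.
Qed.

Theorem lemma4p2 (R : realType) (d : nat) (beta theta : R)
    (hbeta0 : 0 < beta) (hbeta : beta < Num.min 2 d%:R) (htheta : 0 < theta) :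
  (forall (disp : measure_display) (Omega : measurableType disp)
      (P : probability Omega R) (u : R -> Rn R d -> {RV P >-> R}),
    wave_solution beta theta u ->
    forall (x : Rn R d) (delta : R) (m : nat), 0 < delta ->
    forall i j : nat, (1 <= i <= m)%N -> (1 <= j <= m)%N ->
      covariance P (Ite u delta x i) (Ite u delta x j) =
      (delta `^ (3 - beta) *
        ((minn i j)%:R * (8 / ((2 * pi) ^+ d * theta `^ (beta / 2)) *
            \int[lebesgue_Rn d]_w
              (cos ((i%:R - j%:R) * enorm w) * gte beta w)) +
         Rem d beta theta i j))%:E) /\
  (exists C : R, forall i j : nat, (1 <= i)%N -> (1 <= j)%N ->
    `|Rem d beta theta i j| <= C).
Proof.
move: hbeta; rewrite lt_min => /andP[b2 /ltW bd].
split; last first.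
  have [C HC] := @bounded_Rem R d beta theta hbeta0 b2 bd.
  by exists C => i j _ _.
move=> disp Omega P u [[_ mean0] cov] x delta m de0 i j /andP[i0 _] /andP[j0 _].
pose X p : Omega -> R := u (obs_time delta p) x.
pose K := delta `^ (3 - beta) / ((2 * pi) ^+ d * theta `^ (beta / 2)).
pose I p q := \int[lebesgue_Rn d]_w
  (wave_profile p%:R q%:R (enorm w) * enorm w `^ (beta - d%:R - 2)).
have t0 p : 0 <= obs_time delta p by rewrite mulr_ge0// ltW.
have EX p q : ('E_P[fun w => (X p w * X q w)%R] = (K * I p q)%:E)%E.
  have [fE cE] := cov _ x _ x (t0 p) (t0 q).
  rewrite -(fineK fE); congr EFin; have := cE.
  rewrite (@wave_cov_obs R d beta theta delta p%:R q%:R x _ _ _ _ _ _ _).2 ?ler0n//.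
  (* The covariance identity is between complex numbers; its real part is the moment. *)
  by move=> /(congr1 (@complex.Re R)).
have X2 p : X p \in Lfun P 2%:E.
  apply: Lfun2_of_sqr_fin; first exact: measurable_funP.
  by have := EX p p; rewrite unlock => ->.
have Xcov p q : covariance P (X p) (X q) = (K * I p q)%:E.
  have Pfin : P setT \is a fin_num := fin_num_measure P _ measurableT.
  rewrite covarianceE.
  (* Centring reduces the covariance to the mixed second moment. *)
  - rewrite (mean0 (obs_time delta p, x))//= mul0e sube0; exact: EX.
  - exact: (Lfun_subset12 Pfin (X2 _)).
  - exact: (Lfun_subset12 Pfin (X2 _)).
  - exact: (Lfun2_mul_Lfun1 (X2 _) (X2 _)).
transitivity (diff2 (fun p => diff2 (fun q => K * I p q) j) i)%:E.
  (* [Ite] unfolds to [diff2] applied to the observations [X]. *)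
  exact: (covariance_diff2 i j X2 Xcov).
congr EFin.
transitivity (K * diff2 (fun p => diff2 (I p) j) i).
  by rewrite /diff2; ring.
rewrite (@Rintegral_wave_diff2 R d beta i j hbeta0 b2 bd i0 j0).
rewrite /Rem /Rem1 /Rem23 /K.
have pid : (2 * pi : R) ^+ d != 0.
  by rewrite expf_neq0// mulf_neq0// gt_eqF ?pi_gt0.
by field; rewrite pid gt_eqF ?powR_gt0.
Qed.
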